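(* There is an absolute constant $c>0$ such that the following holds. Let $(\mathcal{A},E)$ be a non-commutative probability space, let $n\ge 1$, and let $X_1,\dots,X_n\in\mathcal{A}$ be positive (self-adjoint) free identically-distributed random variables with $E(X_i)=1$. Let $Y_n=X_1\circ X_2\circ\cdots\circ X_n$. Then: (1) $\|Y_n\|\le c\,\|X_i\|\,n$; and (2) $\|Y_n\|\ge \sigma(X_i)\sqrt{n}$.
   Context: A non-commutative probability space $(\mathcal{A},E)$ is a unital $C^*$-algebra $\mathcal{A}$ with a positive linear functional $E$ such that $E(I)=1$ and which is tracial: $E(AB)=E(BA)$ for all $A,B\in\mathcal{A}$. It is assumed that $E$ is faithful ($E(A^*A)=0$ implies $A=0$), so that for a positive $A$ the norm $\|A\|$ is the smallest $t$ such that the spectral measure of $A$ is supported in $[0,t]$. Elements of $\mathcal{A}$ are called random variables; $\|\cdot\|$ is the operator ($C^*$-) norm. Freeness: unital subalgebras $\mathcal{A}_1,\dots,\mathcal{A}_r$ of $\mathcal{A}$ are free if $E(a_1\cdots a_m)=0$ whenever $a_i\in\mathcal{A}_{k(i)}$, $E(a_i)=0$ for all $i$, $k(i)\ne k(i+1)$ for every $i<m$, and $k(m)\neq k(1)$. (Since $E$ is tracial, this is equivalent to the usual definition without the condition $k(m)\ne k(1)$.) Elements are free if the unital subalgebras they generate are free. Self-adjoint variables are identically distributed if they have the same moments $E(X^k)$, $k\ge1$ (then $\|X_i\|$ and $\sigma(X_i)$ do not depend on $i$). For positive $A,B$: $A\circ B=A^{1/2}BA^{1/2}$; products are formed starting from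 the right: $X_1\circ X_2\circ\cdots\circ X_n=X_1\circ(X_2\circ(\cdots\circ X_n))$. Variance: $\sigma^2(A)=E(A^*A)-|E(A)|^2$, $\sigma(A)=\sqrt{\sigma^2(A)}\ge0$. *)

(* Defs.v *)
From HB Require Import structures.
From mathcomp Require Import all_boot all_order all_algebra.
From mathcomp Require Import complex.
From mathcomp Require Import boolp classical_sets reals.

Set Implicit Arguments.
Unset Strict Implicit.
Unset Printing Implicit Defensive.

Import Order.TTheory GRing.Theory Num.Theory.

Local Open Scope classical_set_scope.
Local Open Scope ring_scope.
Local Open Scope complex_scope.

(* The norm is a separate R-valued field because a structure joining [algType]
   with [completeNormedModType] is rejected by Hierarchy Builder: rings and
   normed groups have no common structure below [numDomainType].  [algType]
   excludes the zero algebra, which carries no functional E with E 1 = 1. *)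
HB.mixin Record Algebra_isCStar (R : realType) A of GRing.Algebra R[i] A := {
  adj : A -> A;
  cnorm : A -> R;
  adjK : involutive adj;
  adjD : {morph adj : a b / a + b};
  adjZ : forall (k : R[i]) (a : A), adj (k *: a) = Num.conj k *: adj a;
  adjM : forall a b : A, adj (a * b) = adj b * adj a;
  cnorm0_eq0 : forall a : A, cnorm a = 0 -> a = 0;
  cnormD : forall a b : A, cnorm (a + b) <= cnorm a + cnorm b;
  cnormZ : forall (k : R[i]) (a : A), (cnorm (k *: a))%:C = `|k| * (cnorm a)%:C;
  cnormM : forall a b : A, cnorm (a * b) <= cnorm a * cnorm b;
  cnorm_adj_mul : forall a : A, cnorm (adj a * a) = cnorm a ^+ 2;
  cnorm_complete : forall u : nat -> A,
    (forall e : R, 0 < e -> exists N, forall m n,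
        (N <= m)%N -> (N <= n)%N -> cnorm (u m - u n) < e) ->
    exists l : A, forall e : R, 0 < e -> exists N, forall n,
        (N <= n)%N -> cnorm (u n - l) < e
}.

#[short(type="cstarAlgType")]
HB.structure Definition CStarAlgebra (R : realType) :=
  { A of GRing.Algebra R[i] A & Algebra_isCStar R A }.

Section CStar.
Context {R : realType} {A : cstarAlgType R}.
Implicit Types (a b : A) (E : {scalar A}).

Definition cpositive a := exists b, a = adj b * b.

(* [0] if there is no positive square root; on a positive [a] it is the unique
   one. *)
Definition csqrt a : A := xget 0 [set b | cpositive b /\ b ^+ 2 = a].

Definition circ a b : A := csqrt a * b * csqrt a.

(* circ x1 (circ x2 (... xn)); the value on the empty sequence is irrelevant. *)
Fixpoint circ_prod (s : seq A) : A :=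
  match s with
  | [::] => 1
  | [:: x] => x
  | x :: s' => circ x (circ_prod s')
  end.

Definition prob_space E :=
  [/\ forall a, 0 <= E (adj a * a),
      E 1 = 1,
      forall a b, E (a * b) = E (b * a)
    & forall a, E (adj a * a) = 0 -> a = 0].

Definition unital_subalgebra (B : set A) := GRing.subalg_closed (mem B).

Definition generated_subalgebra (S : set A) : set A :=
  smallest unital_subalgebra S.

(* Cyclic form: the first and last indices are also required to differ, which
   for tracial E is equivalent to freeness.  Words are indexed by ['I_m.+1],
   as the empty word must be excluded. *)
Definition free_subalgebras E (I : Type) (B : I -> set A) :=
  forall (m : nat) (k : 'I_m.+1 -> I) (a : 'I_m.+1 -> A),
    (forall i, B (k i) (a i)) ->
    (forall i, E (a i) = 0) ->
    (forall i j : 'I_m.+1, j = i.+1 :> nat -> k i <> k j) ->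
    k ord_max <> k ord0 ->
    E (\prod_(i < m.+1) a i) = 0.

Definition free_variables E (I : Type) (X : I -> A) :=
  free_subalgebras E (fun i => generated_subalgebra [set X i]).

Definition identically_distributed E (I : Type) (X : I -> A) :=
  forall i j (k : nat), (0 < k)%N -> E (X i ^+ k) = E (X j ^+ k).

Definition variance E a : R[i] := E (adj a * a) - `|E a| ^+ 2.

(* The variance is a nonnegative real element of R[i]. *)
Definition stddev E a : R := Num.sqrt (complex.Re (variance E a)).

End CStar.

(* Main.v *)
(** For positive free [X] and [Z], the variables [X o Z] and [Z X] have the same
moments. If [E (1 - v X)^-1 = E (1 - w Z)^-1 = 1 / e], then [al = 1 - e (1 - v X)^-1]
and [be = 1 - e (1 - w Z)^-1] are centered and [1 - (v w / (1 - e)) Z X] factors as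
[(1 - w Z) (1 - be al / (1 - e)) (1 - v X) / e], so freeness gives
[E (1 - (v w / (1 - e)) Z X)^-1 = 1 / e]. By induction on [n],
[E (1 - z Y_n)^-1 = E (1 - t X)^-1] for small [t] and [z = t / h(t)^(n-1)], where
[h(t) = \sum_k b_(k+1) t^k] and the Boolean cumulants [b] of [X] satisfy
[0 <= b_(k+1) <= ||X||^k]. Hence [E (Y_n^k)] is the coefficient of [z^k] in a series
with nonnegative coefficients, obtained from the moments of [X] by substituting the
solution of [t = z h(t)^(n-1)]; evaluating at [z = 1 / (4 n ||X||)] bounds it by
[2 (4 n ||X||)^k], and faithfulness of [E] turns this into [||Y_n|| <= 4 n ||X||].
The lower bound is [||Y_n||^2 >= E (Y_n^2) = 1 + n sigma^2]. *)

Require Import Defs.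
From mathcomp Require Import all_boot all_order all_algebra.
From mathcomp Require Import complex.
From mathcomp Require Import boolp classical_sets reals.
From mathcomp Require Import ring lra.

Set Implicit Arguments.
Unset Strict Implicit.
Unset Printing Implicit Defensive.

Import Order.TTheory GRing.Theory Num.Theory.

Local Open Scope ring_scope.
Local Open Scope complex_scope.

(** * Norms, limits and square roots *)

(** The argument uses no spectral theory: roots come from an explicit iteration, and where a sign
    has to be decided the faithful trace replaces functional calculus. Freeness is given for plain
    algebras and in cyclic form, while square roots and resolvents live only in norm closures; hence
    the passage to closures, to ordinary alternating words, and to the pair formed by one variable
    and the rest. The resolvent identity holds only for small t > 0, below thresholds that depend on
    all the data. Therefore only asymptotic expansions at 0 are compared, and the thresholds never
    enter the bound. Nonnegativity of the Boolean cumulants is decisive: a coefficient of the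
    inverted series is then controlled by the value of the series at one point, without tracking any
    cancellation. *)

Section Norm.
Context {R : realType} {A : cstarAlgType R}.
Implicit Types (a b x y : A) (r : R).

Lemma real_complexI r s : r%:C = s%:C -> r = s.
Proof. by case. Qed.

Lemma cnormZr r a : cnorm (r%:C *: a) = `|r| * cnorm a.
Proof. by apply: real_complexI; rewrite cnormZ normc_def /= expr0n addr0 sqrtr_sqr -rmorphM. Qed.

Lemma cnorm0 : cnorm (0 : A) = 0.
Proof.
rewrite -(scale0r (0 : A)) -[X in X *: _](rmorph0 (real_complex R)).
by rewrite cnormZr normr0 mul0r.
Qed.

Lemma cnormN a : cnorm (- a) = cnorm a.
Proof.
rewrite -scaleN1r -[X in X *: _]/(- 1%:C) -[- 1%:C](rmorphN (real_complex R)).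
by rewrite cnormZr normrN1 mul1r.
Qed.

Lemma cnorm_ge0 a : 0 <= cnorm a.
Proof. by have := cnormD a (- a); rewrite subrr cnorm0 cnormN; lra. Qed.

Lemma cnorm_small a : (forall e, 0 < e -> cnorm a < e) -> a = 0.
Proof.
move=> H; apply: cnorm0_eq0; apply/eqP; rewrite eq_le cnorm_ge0 andbT leNgt.
by apply/negP => /H; rewrite ltxx.
Qed.

Lemma cnorm_eq0 a : (cnorm a == 0) = (a == 0).
Proof. by apply/eqP/eqP => [/cnorm0_eq0//|->]; exact: cnorm0. Qed.

Lemma cnormB a b : cnorm (a - b) <= cnorm a + cnorm b.
Proof. by rewrite -(cnormN b) cnormD. Qed.

Lemma cadj0 : adj (0 : A) = 0.
Proof. by rewrite -[in LHS](scale0r (0 : A)) Defs.adjZ rmorph0 scale0r. Qed.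

Lemma cadjN : {morph (@adj R A) : a / - a}.
Proof. by move=> a; rewrite -scaleN1r Defs.adjZ rmorphN1 scaleN1r. Qed.

Lemma cadjB : {morph (@adj R A) : a b / a - b}.
Proof. by move=> a b; rewrite adjD cadjN. Qed.

Lemma cadj1 : adj (1 : A) = 1.
Proof. by rewrite -[LHS]mulr1 -[X in _ * X]adjK -adjM mulr1 adjK. Qed.

Lemma conj_real r : Num.conj r%:C = r%:C.
Proof. by apply: conj_Creal; rewrite complex_real. Qed.

Lemma cadjZr r a : adj (r%:C *: a) = r%:C *: adj a.
Proof. by rewrite Defs.adjZ conj_real. Qed.

Lemma cadjX n : {morph (@adj R A) : a / a ^+ n}.
Proof.
move=> a; elim: n => [|n IH]; first by rewrite !expr0 cadj1.
by rewrite exprS adjM IH -exprSr.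
Qed.

Lemma cnorm_adj a : cnorm (adj a) = cnorm a.
Proof.
suff le x : cnorm x <= cnorm (adj x).
  by apply/eqP; rewrite eq_le -{2}(adjK a) !le.
have := cnormM (adj x) x; rewrite cnorm_adj_mul expr2.
have [->|nz] := eqVneq (cnorm x) 0; first by rewrite cnorm_ge0.
by rewrite ler_pM2r // lt_neqAle eq_sym nz cnorm_ge0.
Qed.

Lemma cnorm_sq x : adj x = x -> cnorm (x ^+ 2) = cnorm x ^+ 2.
Proof. by move=> sx; rewrite -cnorm_adj_mul sx. Qed.

Lemma cnorm1 : cnorm (1 : A) = 1.
Proof.
have nz : cnorm (1 : A) != 0 by rewrite cnorm_eq0 oner_eq0.
apply: (mulfI nz); rewrite mulr1 -expr2 -cnorm_sq ?cadj1 //.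
by rewrite expr1n.
Qed.

Lemma cnormX a n : cnorm (a ^+ n) <= cnorm a ^+ n.
Proof.
elim: n => [|n IH]; first by rewrite !expr0 cnorm1.
rewrite !exprS (le_trans (cnormM _ _)) //.
by rewrite ler_wpM2l // cnorm_ge0.
Qed.

Definition climit (u : nat -> A) a :=
  forall e : R, 0 < e -> exists N, forall n, (N <= n)%N -> cnorm (u n - a) < e.

Lemma climit_le (u : nat -> A) a C : 
  climit u a -> (forall n, cnorm (u n) <= C) -> cnorm a <= C.
Proof.
move=> ua uC; apply/ler_addgt0Pr => e /ua [N /(_ _ (leqnn N))] uN.
have := cnormB (u N) (u N - a); rewrite opprB addrC subrK.
by have := uC N; lra.
Qed.

Lemma climit_uniq u a b : climit u a -> climit u b -> a = b.
Proof.
move=> ua ub; apply/eqP; rewrite -subr_eq0; apply/eqP; apply: cnorm_small => e e0.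
have e2 : 0 < e / 2 by lra.
have [N1 h1] := ua _ e2; have [N2 h2] := ub _ e2.
have {}h1 := h1 _ (leq_maxl N1 N2); have {}h2 := h2 _ (leq_maxr N1 N2).
have := cnormB (u (maxn N1 N2) - b) (u (maxn N1 N2) - a).
by rewrite opprB addrC addrA subrK; lra.
Qed.

Lemma climit_cst a : climit (fun=> a) a.
Proof. by move=> e e0; exists 0%N => n _; rewrite subrr cnorm0. Qed.

Lemma climit_sub u a (s : nat -> nat) : (forall n, n <= s n)%N ->
  climit u a -> climit (fun n => u (s n)) a.
Proof.
move=> sn ua e /ua [N h]; exists N => n Nn; apply: h.
exact: leq_trans Nn (sn n).
Qed.

Lemma climit_bound (u : nat -> A) a (f : A -> A) C :
  (forall n, cnorm (f (u n) - f a) <= C * cnorm (u n - a)) ->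
  climit u a -> climit (fun n => f (u n)) (f a).
Proof.
move=> H ua e e0; have C0 : 0 < `|C| + 1 by rewrite ltr_wpDl.
have [N h] := ua _ (divr_gt0 e0 C0); exists N => n /h.
rewrite ltr_pdivlMr // => /(le_lt_trans _) -> //.
rewrite (le_trans (H n)) // mulrC ler_wpM2l ?cnorm_ge0 //.
by rewrite (le_trans (ler_norm _)) // lerDl.
Qed.

Lemma climitD u v a b : climit u a -> climit v b ->
  climit (fun n => u n + v n) (a + b).
Proof.
move=> ua ub e e0; have e2 : 0 < e / 2 by lra.
have [N1 h1] := ua _ e2; have [N2 h2] := ub _ e2.
exists (maxn N1 N2) => n; rewrite geq_max => /andP[/h1 {}h1 /h2 {}h2].
rewrite opprD addrACA; have := cnormD (u n - a) (v n - b); lra.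
Qed.

Lemma climitZ k u a : climit u a -> climit (fun n => k *: u n) (k *: a).
Proof.
have [r kr] : exists r, `|k| = r%:C by rewrite normc_def; eexists.
apply: (@climit_bound _ _ _ r) => n.
by rewrite -scalerBr -lecR cnormZ kr -rmorphM.
Qed.

Lemma climit_adj u a : climit u a -> climit (fun n => adj (u n)) (adj a).
Proof. by apply: (@climit_bound _ _ _ 1) => n; rewrite -cadjB cnorm_adj mul1r. Qed.

Lemma climitMl b u a : climit u a -> climit (fun n => b * u n) (b * a).
Proof. by apply: (@climit_bound _ _ _ (cnorm b)) => n; rewrite -mulrBr cnormM. Qed.

Lemma climitMr b u a : climit u a -> climit (fun n => u n * b) (a * b).
Proof.
by apply: (@climit_bound _ _ (fun x => x * b) (cnorm b)) => n; rewrite -mulrBl mulrC cnormM.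
Qed.

Lemma climit_sq u a C : (forall n, cnorm (u n) <= C) -> climit u a ->
  climit (fun n => u n ^+ 2) (a ^+ 2).
Proof.
move=> uC ua; apply: (@climit_bound u a (fun x => x ^+ 2) (C + cnorm a)) => // n.
rewrite (_ : _ - _ = u n * (u n - a) + (u n - a) * a); last first.
  by rewrite mulrBr mulrBl addrA subrK.
rewrite (le_trans (cnormD _ _)) // [leRHS]mulrDl lerD //.
  by rewrite (le_trans (cnormM _ _)) // ler_wpM2r ?cnorm_ge0.
by rewrite mulrC (le_trans (cnormM _ _)) // mulrC.
Qed.

Lemma inv_small (e : R) : 0 < e -> exists N, forall n, (N <= n)%N -> 2 / n.+2%:R < e.
Proof.
move=> e0; have [N hN] : exists N : nat, 2 / e < N%:R.
  by exists (Num.bound (2 / e)); rewrite archi_boundP // ltW // divr_gt0.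
exists N => n Nn; rewrite ltr_pdivrMr ?ltr0n // mulrC -ltr_pdivrMr //.
by apply: lt_le_trans hN _; rewrite ler_nat -addn2 (leq_trans Nn) // leq_addr.
Qed.

(* The iteration y := (x + y^2) / 2 converges to 1 - sqrt (1 - x). *)
Fixpoint sqrt_iter x n : A :=
  if n is n'.+1 then (2^-1 : R)%:C *: (x + sqrt_iter x n' ^+ 2) else 0.

(** The same iteration on the scalar 1, the worst case of [cnorm x <= 1]: it majorizes the norms of
    the iterates and of their increments. *)
Fixpoint sqrt_bound n : R :=
  if n is n'.+1 then 2^-1 * (1 + sqrt_bound n' ^+ 2) else 0.

Lemma sqrt_bound_ge0 n : 0 <= sqrt_bound n.
Proof. by case: n => [//|n /=]; rewrite mulr_ge0 ?invr_ge0 // addr_ge0 ?sqr_ge0. Qed.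

Lemma sqrt_bound_le1 n : sqrt_bound n <= 1.
Proof. elim: n => [|n IH] /=; first by []. have := sqrt_bound_ge0 n; nra. Qed.

Lemma sqrt_bound_close n : 1 - sqrt_bound n <= 2 / n.+2%:R.
Proof.
elim: n => [|n IH] /=; first by rewrite subr0 divff // pnatr_eq0.
have n0 : 0 < n.+2%:R :> R by rewrite ltr0n.
rewrite ler_pdivlMr // in IH; rewrite ler_pdivlMr ?ltr0n // -(natr1 n.+2).
have := sqrt_bound_ge0 n; have := sqrt_bound_le1 n.
have : 1 <= n.+2%:R :> R by rewrite ler1n.
move: IH; set q := sqrt_bound n; set m := n.+2%:R : R => IH m1 q1 q0.
(* For d = 1 - q the recursion reads d -> d - d^2 / 2, and d <= 2 / m then gives at most 2 / (m +
   1). *)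
have -> : 1 - 2^-1 * (1 + q ^+ 2) = (1 - q) * (1 + q) / 2 by field.
set d := 1 - q in IH *; have -> : 1 + q = 2 - d by rewrite /d; lra.
have d0 : 0 <= d by rewrite subr_ge0.
have d1 : d <= 1 by rewrite /d; lra.
nra.
Qed.

Lemma sqrt_iter_commute x y n : GRing.comm y x -> GRing.comm y (sqrt_iter x n).
Proof.
move=> yx; elim: n => [|n IH] /=; first exact: commr0.
rewrite /GRing.comm -scalerAl -scalerAr; congr (_ *: _).
by apply: commrD => //; exact: commrX.
Qed.

Lemma sqrt_iter_le x n : cnorm x <= 1 -> cnorm (sqrt_iter x n) <= sqrt_bound n.
Proof.
move=> x1; elim: n => [|n IH] /=; first by rewrite cnorm0.
rewrite cnormZr ger0_norm ?invr_ge0 // ler_wpM2l ?invr_ge0 //.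
rewrite (le_trans (cnormD _ _)) // lerD // (le_trans (cnormX _ _)) //.
by rewrite lerXn2r // nnegrE ?cnorm_ge0 // sqrt_bound_ge0.
Qed.

(** Commuting iterates give u^2 - v^2 = (u - v)(u + v), the factorization that the scalar increments
    satisfy as well. *)
Lemma sqrt_iter_step x n : cnorm x <= 1 ->
  cnorm (sqrt_iter x n.+1 - sqrt_iter x n) <= sqrt_bound n.+1 - sqrt_bound n.
Proof.
move=> x1; elim: n => [|n IH].
  by rewrite !subr0 /= !expr0n /= !addr0 cnormZr ger0_norm ?invr_ge0 //
    ler_wpM2l ?invr_ge0.
set u := sqrt_iter x n.+1 in IH *; set v := sqrt_iter x n in IH *.
have cuv : GRing.comm u v.
  by apply: sqrt_iter_commute; apply: commr_sym; apply: sqrt_iter_commute.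
have -> : sqrt_iter x n.+2 - u = (2^-1 : R)%:C *: ((u - v) * (u + v)).
  rewrite mulrDr !mulrBl cuv addrA subrK -!expr2 {2}/u /= -/u -/v -scalerBr.
  by congr (_ *: _); rewrite opprD addrACA subrr add0r.
have -> : sqrt_bound n.+2 - sqrt_bound n.+1 =
    2^-1 * ((sqrt_bound n.+1 - sqrt_bound n) * (sqrt_bound n.+1 + sqrt_bound n)).
  have -> : sqrt_bound n.+2 = 2^-1 * (1 + sqrt_bound n.+1 ^+ 2) by [].
  by rewrite {2}[sqrt_bound n.+1]/=; field.
rewrite cnormZr ger0_norm ?invr_ge0 // ler_wpM2l ?invr_ge0 //.
rewrite (le_trans (cnormM _ _)) // ler_pM ?cnorm_ge0 //.
by rewrite (le_trans (cnormD _ _)) // lerD //; exact: sqrt_iter_le.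
Qed.

Lemma sqrt_iter_diff x n k : cnorm x <= 1 ->
  cnorm (sqrt_iter x (k + n) - sqrt_iter x n) <= 2 / n.+2%:R.
Proof.
move=> x1; apply: le_trans (sqrt_bound_close n).
apply: (@le_trans _ _ (sqrt_bound (k + n) - sqrt_bound n)); last first.
  by rewrite lerD2r sqrt_bound_le1.
elim: k => [|k IH]; first by rewrite !subrr cnorm0.
rewrite addSn -[X in cnorm (X - _)](subrK (sqrt_iter x (k + n))) -addrA.
rewrite (le_trans (cnormD _ _)) // (le_trans (lerD (sqrt_iter_step _ x1) IH)) //.
by rewrite addrA subrK.
Qed.

(** At [cnorm x = 1] the increments need not decay geometrically; the Cauchy modulus comes from the
    rate 2 / (n + 2) of the scalar iteration. *)
Lemma csqrt_exists x : cnorm x <= 1 ->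
  exists y, [/\ climit (sqrt_iter x) y, (1 - y) ^+ 2 = 1 - x & cnorm y <= 1].
Proof.
move=> x1.
have [y yl] : exists y, climit (sqrt_iter x) y.
  apply: cnorm_complete => e e0.
  have e2 : 0 < e / 2 by lra.
  have [N hN] := inv_small e2; exists N => m n Nm Nn.
  have := hN _ (leqnn N); have := sqrt_iter_diff N (m - N) x1.
  have := sqrt_iter_diff N (n - N) x1; rewrite !subnK //.
  have := cnormB (sqrt_iter x m - sqrt_iter x N) (sqrt_iter x n - sqrt_iter x N).
  by rewrite opprB addrA subrK; set d := 2 / _; lra.
have yb n : cnorm (sqrt_iter x n) <= 1.
  exact: le_trans (sqrt_iter_le n x1) (sqrt_bound_le1 n).
exists y; split=> //; last exact: climit_le yl yb.
have E : y = (2^-1 : R)%:C *: (x + y ^+ 2).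
  apply: (@climit_uniq (fun n => sqrt_iter x n.+1)); first exact: (climit_sub (s := S)).
  apply: climitZ; apply: climitD; first exact: climit_cst.
  exact: climit_sq yb yl.
have E2 : y *+ 2 = x + y ^+ 2.
  rewrite {1}E -scaler_nat scalerA -[2%:R](rmorph_nat (real_complex R)) -rmorphM.
  by rewrite mulfV ?pnatr_eq0 // rmorph1 scale1r.
rewrite expr2 mulrBr !mulrBl !mulr1 !mul1r -addrA -opprD addrA -mulr2n E2 -expr2.
by rewrite addrK.
Qed.

Lemma climit_adj_fix u a : (forall n, adj (u n) = u n) -> climit u a -> adj a = a.
Proof.
move=> su ua; apply: climit_uniq (ua).
by move=> e /(climit_adj ua) [N h]; exists N => n /h; rewrite su.
Qed.

Lemma climit_comm u a y : (forall n, GRing.comm y (u n)) -> climit u a -> GRing.comm y a.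
Proof.
move=> su ua; apply: (@climit_uniq (fun n => y * u n)); first exact: climitMl.
by move=> e /(climitMr y ua) [N h]; exists N => n /h; rewrite su.
Qed.

Lemma sqrt_iter_adj x n : adj x = x -> adj (sqrt_iter x n) = sqrt_iter x n.
Proof.
move=> sx; elim: n => [|n IH] /=; first by rewrite cadj0.
by rewrite cadjZr adjD cadjX IH sx.
Qed.

Lemma geom_sumMr (x : A) n : (\sum_(i < n) x ^+ i) * (1 - x) = 1 - x ^+ n.
Proof.
elim: n => [|n IH]; first by rewrite big_ord0 mul0r expr0 subrr.
by rewrite big_ord_recr /= mulrDl IH mulrBr mulr1 -exprSr addrA subrK.
Qed.

Lemma geom_sumMl (x : A) n : (1 - x) * (\sum_(i < n) x ^+ i) = 1 - x ^+ n.
Proof.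
elim: n => [|n IH]; first by rewrite big_ord0 mulr0 expr0 subrr.
by rewrite big_ord_recr /= mulrDr IH mulrBl mul1r -exprS addrA subrK.
Qed.

Lemma neumann_exists x : cnorm x < 1 ->
  exists y, [/\ climit (fun n => \sum_(i < n) x ^+ i) y, y * (1 - x) = 1 & (1 - x) * y = 1].
Proof.
move=> x1; set q := cnorm x in x1; have q0 : 0 <= q := cnorm_ge0 x.
have q1 : 0 < 1 - q by lra.
pose u n := \sum_(i < n) x ^+ i.
have uS n : u n.+1 = u n + x ^+ n by rewrite /u big_ord_recr.
have diff n k : cnorm (u (k + n)%N - u n) * (1 - q) <= q ^+ n * (1 - q ^+ k).
  elim: k => [|k IH]; first by rewrite subrr cnorm0 mul0r expr0 subrr mulr0.
  rewrite addSn uS addrAC.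
  have := cnormD (u (k + n)%N - u n) (x ^+ (k + n)).
  have := cnormX x (k + n); rewrite -/q (exprD q) exprS.
  have := exprn_ge0 k q0; have := exprn_ge0 n q0.
  move: IH; set a := cnorm _; set b := cnorm _; set c := cnorm _.
  set s := q ^+ k; set t := q ^+ n; move=> IH t0 s0 bl cl.
  have : c * (1 - q) <= (a + b) * (1 - q) by rewrite ler_pM2r.
  have : b * (1 - q) <= s * t * (1 - q) by rewrite ler_pM2r.
  nra.
have small e : 0 < e -> exists N, q ^+ N < e.
  move=> e0.
  have [N hN] : exists N : nat, (e * (1 - q))^-1 < N%:R.
    by exists (Num.bound ((e * (1 - q))^-1)); rewrite archi_boundP // invr_ge0 ltW // mulr_gt0.
  exists N; rewrite ltNge; apply/negP => eq.
  (* This is N q^N <= 1 + q + ... + q^(N-1) multiplied by 1 - q; it forces q^N to 0. *)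
  have B : N%:R * (1 - q) * q ^+ N <= 1 - q ^+ N.
    elim: (N) => [|m IH]; first by rewrite mul0r mul0r expr0 subrr.
    have := exprn_ge0 m q0; move: IH; rewrite exprS -natr1; set s := q ^+ m => IH s0.
    have qs : q * s <= 1 by rewrite /s -exprS exprn_ile1 // ltW.
    have := ler_wpM2l q0 IH; have : (1 - q) * (q * s) <= (1 - q) * 1.
      by rewrite ler_pM2l.
    by rewrite mulrBr mulr1; set p := m%:R; lra.
  have eq0 : 0 < e * (1 - q) by rewrite mulr_gt0.
  move: hN; rewrite -div1r ltr_pdivrMr // => hN.
  have : N%:R * (1 - q) * e <= N%:R * (1 - q) * q ^+ N.
    by rewrite ler_wpM2l // mulr_ge0 // ltW.
  have := exprn_ge0 N q0; move: B hN; set p := N%:R; set t := q ^+ N; lra.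
have [y yl] : exists y, climit u y.
  apply: cnorm_complete => e e0.
  have e2 : 0 < e / 2 * (1 - q) by rewrite mulr_gt0 // divr_gt0.
  have [N hN] := small _ e2; exists N => m n Nm Nn.
  have close k : (N <= k)%N -> cnorm (u k - u N) < e / 2.
    move=> Nk; have := diff N (k - N)%N; rewrite subnK // => H.
    rewrite -(ltr_pM2r q1) (le_lt_trans H) // (le_lt_trans _ hN) //.
    by rewrite ler_piMr ?exprn_ge0 // lerBlDr lerDl exprn_ge0.
  have := close _ Nm; have := close _ Nn.
  have := cnormB (u m - u N) (u n - u N).
  by rewrite opprB addrA subrK; lra.
have xl : climit (fun n => x ^+ n) 0.
  move=> e /small [N hN]; exists N => n Nn; rewrite subr0 (le_lt_trans _ hN) //.
  rewrite (le_trans (cnormX _ _)) // -/q -(subnK Nn) exprD ler_piMl ?exprn_ge0 //.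
  by rewrite exprn_ile1 // ltW.
have xl1 : climit (fun n => 1 - x ^+ n) 1.
  move=> e /xl [N h]; exists N => n /h; rewrite subr0.
  by rewrite addrAC subrr add0r cnormN.
exists y; split=> //.
  apply: climit_uniq xl1 => e /(climitMr (1 - x) yl) [N h].
  by exists N => n /h; rewrite geom_sumMr.
apply: climit_uniq xl1 => e /(climitMl (1 - x) yl) [N h].
by exists N => n /h; rewrite geom_sumMl.
Qed.

End Norm.

(** * Square roots, absolute values and negative parts *)

Section SquareRoots.
Context {R : realType} {A : cstarAlgType R}.
Implicit Types (a b x y p r : A).

Lemma scaler_real (r s : R) a : r%:C *: (s%:C *: a) = (r * s)%:C *: a.
Proof. by rewrite scalerA -rmorphM. Qed.

Lemma scalerC1 a : 1%:C *: a = a.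
Proof. exact: scale1r. Qed.

Lemma scaler_half2 a : (2^-1 : R)%:C *: (a + a) = a.
Proof.
have E : (2^-1 + 2^-1 : R) = 1 by lra.
by rewrite scalerDr -scalerDl -rmorphD E scalerC1.
Qed.

Definition closed_subalgebra (B : A -> Prop) := [/\ B 1,
  forall k a b, B a -> B b -> B (k *: a + b), forall a b, B a -> B b -> B (a * b)
  & forall u a, (forall n, B (u n)) -> climit u a -> B a].

(** Stands in for the statement that [b] is a function of [a]. *)
Definition bicommuting a b := forall y, GRing.comm y a -> GRing.comm y b.

Definition self_adjoint a := adj a = a.

Lemma csaB a b : self_adjoint a -> self_adjoint b -> self_adjoint (a - b).
Proof. by rewrite /self_adjoint cadjB => -> ->. Qed.

Lemma csaZ (r : R) a : self_adjoint a -> self_adjoint (r%:C *: a).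
Proof. by rewrite /self_adjoint cadjZr => ->. Qed.

Lemma csaX n a : self_adjoint a -> self_adjoint (a ^+ n).
Proof. by rewrite /self_adjoint cadjX => ->. Qed.

Lemma csa1 : self_adjoint (1 : A).
Proof. exact: cadj1. Qed.

Lemma csaM a b : GRing.comm a b -> self_adjoint a -> self_adjoint b -> self_adjoint (a * b).
Proof. by rewrite /self_adjoint adjM => -> -> ->. Qed.

Lemma commZ k a b : GRing.comm a b -> GRing.comm a (k *: b).
Proof. by rewrite /GRing.comm -scalerAl -scalerAr => ->. Qed.

Lemma csquare_adj a b : adj (b * a) * (b * a) = adj a * (adj b * b) * a.
Proof. by rewrite adjM !mulrA. Qed.

Lemma closed_subalgebra0 B : closed_subalgebra B -> B 0.
Proof. by case=> B1 Bl _ _; have := Bl (-1) _ _ B1 B1; rewrite scaleN1r addrC subrr. Qed.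

Lemma closed_subalgebraZ B k a : closed_subalgebra B -> B a -> B (k *: a).
Proof.
by move=> HB Ba; rewrite -[_ *: _]addr0; case: (HB) => _ Bl _ _; apply: Bl => //;
  exact: closed_subalgebra0.
Qed.

Lemma closed_subalgebraD B a b : closed_subalgebra B -> B a -> B b -> B (a + b).
Proof. by case=> _ Bl _ _ Ba Bb; rewrite -(scale1r a); exact: Bl. Qed.

Lemma closed_subalgebraB B a b : closed_subalgebra B -> B a -> B b -> B (a - b).
Proof. by case=> _ Bl _ _ Ba Bb; rewrite addrC -scaleN1r; exact: Bl. Qed.

Lemma closed_subalgebraX B a n : closed_subalgebra B -> B a -> B (a ^+ n).
Proof.
case=> B1 _ BM _ Ba; elim: n => [|n IH]; first by rewrite expr0.
by rewrite exprS; exact: BM.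
Qed.

(** The bound on [1 - r] allows the lemma to be applied again to [r], which yields fourth roots. *)
Lemma sqrt_one_sub x : self_adjoint x -> cnorm x <= 1 -> exists r,
  [/\ self_adjoint r, r ^+ 2 = 1 - x, cnorm (1 - r) <= 1, bicommuting x r
  & forall B, closed_subalgebra B -> B x -> B r].
Proof.
move=> sx x1; have [y [yl y2 y1]] := csqrt_exists x1.
exists (1 - y); split=> //.
- apply: csaB; first exact: csa1.
  by apply: climit_adj_fix yl => n; exact: sqrt_iter_adj.
- by rewrite opprB addrC subrK.
- move=> z zx; apply: commrB; first exact: commr1.
  by apply: climit_comm yl => n; exact: sqrt_iter_commute.
move=> B HB Bx; apply: closed_subalgebraB => //; first by case: HB.
case: (HB) => _ _ _; apply; last exact: yl.
elim=> [|n IH] /=; first exact: closed_subalgebra0.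
apply: closed_subalgebraZ => //; apply: closed_subalgebraD => //.
exact: closed_subalgebraX.
Qed.

(* [p + i r] is a multiple of a unitary. *)
Lemma cnorm_of_sum_squares (K : R) p r : self_adjoint p -> self_adjoint r ->
  GRing.comm p r -> p ^+ 2 + r ^+ 2 = K%:C *: 1 -> cnorm p ^+ 2 <= `|K|.
Proof.
move=> sp sr pr H; pose u := p + 'i%C *: r.
have au : adj u = p - 'i%C *: r.
  by rewrite adjD Defs.adjZ sp sr; congr (_ + _); rewrite -scaleNr; congr (_ *: _);
    apply/eqP; rewrite eq_complex /= oppr0 !eqxx.
have uu : adj u * u = K%:C *: 1.
  rewrite au mulrDr !mulrBl -scalerAl -!scalerAr -scalerAl -H.
  rewrite pr scalerA -['i%C * 'i%C]expr2 sqr_i scaleN1r opprK -!expr2.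
  by rewrite addrA subrK.
have := cnorm_adj_mul u; rewrite uu cnormZr cnorm1 mulr1 => ->.
rewrite ler_sqr ?nnegrE ?cnorm_ge0 //.
have -> : p = (2^-1 : R)%:C *: (u + adj u).
  by rewrite au /u addrACA subrr addr0 scaler_half2.
rewrite cnormZr ger0_norm ?invr_ge0 //.
by have := cnormD u (adj u); rewrite cnorm_adj; lra.
Qed.

(** [r] and a root [s] of [1 - r ^+ 2] are the parts of a unitary, which bounds [s] without
    reference to the spectrum. *)
Lemma cnorm_one_sub_sq r : self_adjoint r -> cnorm (r ^+ 2) <= 1 ->
  cnorm (1 - r ^+ 2) <= 1.
Proof.
move=> sr r1; have [s [ss s2 _ sc _]] := sqrt_one_sub (csaX 2 sr) r1.
rewrite -s2 cnorm_sq // -[leRHS](@ger0_norm R 1) //.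
apply: (@cnorm_of_sum_squares 1 s r) => //; last by rewrite s2 subrK scalerC1.
by apply: commr_sym; apply: sc; apply: commrX.
Qed.

(** [r ^+ 2] is the absolute value of [x], the root of [x ^+ 2]; a second extraction exhibits it as
    a square. *)
Lemma sqrt_of_square x : self_adjoint x -> exists r, [/\ self_adjoint r,
  r ^+ 2 ^+ 2 = x ^+ 2 & bicommuting x r].
Proof.
move=> sx; have [->|x0] := eqVneq x 0.
  by exists 0; split=> [||y _]; [exact: cadj0|rewrite !expr0n|exact: commr0].
have N0 : 0 < cnorm x by rewrite lt_neqAle cnorm_ge0 eq_sym cnorm_eq0 x0.
set N := cnorm x in N0; pose w := (N^-1)%:C *: x.
have sw : self_adjoint w by exact: csaZ.
have w1 : cnorm (w ^+ 2) <= 1.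
  rewrite cnorm_sq // cnormZr ger0_norm ?invr_ge0 ?(ltW N0) //.
  by rewrite -/N mulVf ?gt_eqF // expr1n.
have w1' := cnorm_one_sub_sq sw w1.
have sw' : self_adjoint (1 - w ^+ 2) by apply: csaB; [exact: csa1|exact: csaX].
have [r0 [s0 r02 n0 c0 _]] := sqrt_one_sub sw' w1'.
have s0' : self_adjoint (1 - r0) by apply: csaB => //; exact: csa1.
have [r1 [s1 r12 n1 c1 _]] := sqrt_one_sub s0' n0.
exists ((Num.sqrt N)%:C *: r1); split; first exact: csaZ.
- rewrite !exprZn r12 opprB addrC subrK r02 opprB addrC subrK /w exprZn scalerA.
  rewrite -!rmorphXn -rmorphM sqr_sqrtr ?ltW // -exprMn mulfV ?gt_eqF //.
  by rewrite expr1n rmorph1 scale1r.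
move=> y yx; apply: commZ; apply: c1; apply: commrB; first exact: commr1.
apply: c0; apply: commrB; first exact: commr1.
by apply: commrX; exact: commZ.
Qed.

(** [v] is the negative part and [r ^+ 2] the absolute value of [x]. The identity
    [v * r ^+ 2 = v ^+ 2], once [r] and [v] commute, makes v^3 the square [adj (r * v) * (r * v)];
    positivity of [v] is used in this form only. *)
Lemma negative_part x : self_adjoint x -> exists v r, [/\ self_adjoint v, self_adjoint r,
  v * x = - v ^+ 2, v * r ^+ 2 = v ^+ 2 & bicommuting x r /\ v + v = r ^+ 2 - x].
Proof.
move=> sx; have [r [sr r4 rc]] := sqrt_of_square sx.
pose t := r ^+ 2; pose v := (2^-1 : R)%:C *: (t - x).
have tx : GRing.comm t x.
  by apply: commr_sym; apply: commrX; apply: rc; exact: commr_refl.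
have vv : v + v = t - x by rewrite -scalerDr scaler_half2.
have dx : (t - x) * x = - ((t - x) * t).
  by rewrite !mulrBl tx -expr2 -r4 expr2 opprB.
have dd : (t - x) * (t - x) = (t - x) * t + (t - x) * t.
  by rewrite mulrBr dx opprK.
have v2 : v * t = v ^+ 2.
  by rewrite expr2 /v -!scalerAl -scalerAr dd scaler_half2.
have vx : v * x = - v ^+ 2.
  by rewrite -v2 /v -!scalerAl dx scalerN.
exists v, r; split=> //; apply: csaZ; apply: csaB => //; exact: csaX.
Qed.

End SquareRoots.

(** * Positivity for a faithful trace *)

Section FaithfulTrace.
Context {R : realType} {A : cstarAlgType R} (E : {scalar A}) (HE : prob_space E).
Implicit Types (a b x y p r : A).

Definition real_trace a : R := complex.Re (E a).
Local Notation tau := real_trace.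

Lemma tauD a b : tau (a + b) = tau a + tau b.
Proof. by rewrite /real_trace linearD; case: (E a) => ? ?; case: (E b). Qed.

Lemma tauN a : tau (- a) = - tau a.
Proof. by rewrite /real_trace linearN; case: (E a). Qed.

Lemma tauB a b : tau (a - b) = tau a - tau b.
Proof. by rewrite tauD tauN. Qed.

Lemma tau0 : tau 0 = 0.
Proof. by rewrite /real_trace linear0. Qed.

Lemma EZ k a : E (k *: a) = k * E a.
Proof. by rewrite linearZ. Qed.

Lemma ED a b : E (a + b) = E a + E b.
Proof. exact: linearD. Qed.

Lemma EB a b : E (a - b) = E a - E b.
Proof. exact: linearB. Qed.

Lemma E1 : E 1 = 1. Proof. by case: HE. Qed.

Lemma tau1 : tau 1 = 1. Proof. by rewrite /real_trace E1. Qed.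

Lemma tauZ (k : R) a : tau (k%:C *: a) = k * tau a.
Proof. by rewrite /real_trace EZ; case: (E a) => u v /=; rewrite mul0r subr0. Qed.

Lemma tau_sum (I : Type) (s : seq I) (P : pred I) (F : I -> A) :
  tau (\sum_(i <- s | P i) F i) = \sum_(i <- s | P i) tau (F i).
Proof. exact: (big_morph tau tauD tau0). Qed.

Lemma E_sum (I : Type) (s : seq I) (P : pred I) (F : I -> A) :
  E (\sum_(i <- s | P i) F i) = \sum_(i <- s | P i) E (F i).
Proof. exact: (big_morph E ED (linear0 E)). Qed.

Lemma E_trace a b : E (a * b) = E (b * a). Proof. by case: HE. Qed.

Lemma tau_trace a b : tau (a * b) = tau (b * a).
Proof. by rewrite /real_trace E_trace. Qed.

Lemma E_square a : E (adj a * a) = (tau (adj a * a))%:C.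
Proof.
have : 0 <= E (adj a * a) by case: HE.
by rewrite /real_trace; case: (E _) => u v; rewrite lecE /= => /andP[/eqP-> _].
Qed.

Lemma tau_square_ge0 a : 0 <= tau (adj a * a).
Proof.
have : 0 <= E (adj a * a) by case: HE.
by rewrite E_square ler0c.
Qed.

Lemma tau_sq_ge0 a : self_adjoint a -> 0 <= tau (a ^+ 2).
Proof. by move=> sa; have := tau_square_ge0 a; rewrite sa. Qed.

Lemma tau_faithful a : tau (adj a * a) = 0 -> a = 0.
Proof.
by case: HE => _ _ _ H a0; apply: H; rewrite E_square a0.
Qed.

Lemma tau_faithful_sq a : self_adjoint a -> tau (a ^+ 2) = 0 -> a = 0.
Proof. by move=> sa H; apply: tau_faithful; rewrite sa. Qed.

(** [E] is real on squares; the squares of [1 + a] and [1 + i a] give the imaginary and the real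
    part. *)
Lemma E_adj a : E (adj a) = Num.conj (E a).
Proof.
have h1 := E_square (1 + a); have h2 := E_square (1 + 'i%C *: a).
have i2 : Num.conj ('i%C : R[i]) = - 'i%C by apply/eqP; rewrite eq_complex /= oppr0 !eqxx.
move: h1 h2; rewrite !adjD cadj1 Defs.adjZ i2.
rewrite !mulrDl !mulrDr !mul1r !mulr1 -!scalerAl -!scalerAr scalerA.
rewrite mulNr -expr2 sqr_i opprK scale1r /real_trace !linearD !EZ E1 E_square.
case: (E (adj a)) => u v; case: (E a) => u' v' /= [h1] [h2].
apply/eqP; rewrite eq_complex /=; apply/andP; split; apply/eqP; lra.
Qed.

Lemma E_self_adjoint a : self_adjoint a -> E a = (tau a)%:C.
Proof.
move=> sa; have := E_adj a; rewrite sa /real_trace.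
case: (E a) => u v /= [h]; apply/eqP; rewrite eq_complex /= eqxx /=; apply/eqP; lra.
Qed.

Lemma cpositive_self_adjoint a : cpositive a -> self_adjoint a.
Proof. by case=> b ->; rewrite /self_adjoint adjM adjK. Qed.

Lemma cpositive_sq b : self_adjoint b -> cpositive (b ^+ 2).
Proof. by move=> sb; exists b; rewrite sb. Qed.

(* For the negative part [v] of [b^* b], both [(b v)^* (b v)] and
   [v (b^* b) v = - v^3] have nonnegative trace up to opposite signs. *)
Lemma cpositive_square a : cpositive a ->
  exists r, [/\ self_adjoint r, r ^+ 2 = a & bicommuting a r].
Proof.
move=> pa; have sa := cpositive_self_adjoint pa.
have [v [r [sv sr va vr [rc vv]]]] := negative_part sa.
have rv : v = 0 -> r ^+ 2 = a.
  by move=> v0; apply/eqP; rewrite -subr_eq0 -vv v0 addr0.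
exists r; split=> //; apply: rv.
have ca : GRing.comm a v.
  have -> : v = (2^-1 : R)%:C *: (r ^+ 2 - a) by rewrite -vv scaler_half2.
  by apply: commZ; apply: commrB => //; apply: commrX; apply: rc.
have crv : GRing.comm r v by apply: commr_sym; apply: rc; apply: commr_sym.
case: pa => b ab.
have e1 : adj (b * v) * (b * v) = - (v * v ^+ 2).
  by rewrite csquare_adj -ab sv va mulNr -exprSr -exprS.
have e2 : adj (r * v) * (r * v) = v * v ^+ 2.
  rewrite csquare_adj sr -expr2 sv vr; exact: (esym (exprSr v 2)).
have rv0 : r * v = 0.
  apply: tau_faithful; apply/eqP; rewrite eq_le tau_square_ge0 andbT.
  by rewrite e2 -oppr_ge0 -tauN -e1 tau_square_ge0.
apply: tau_faithful_sq => //.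
by rewrite -vr expr2 mulrA -crv rv0 mul0r tau0.
Qed.

Lemma cnorm_one_sub_positive a : cpositive a -> cnorm a <= 1 -> cnorm (1 - a) <= 1.
Proof.
by move=> /cpositive_square[r [sr <- _]]; exact: cnorm_one_sub_sq.
Qed.

(** The fourth root [q] certifies that [r] is positive. The last clause will put the root of [X i]
    into the closed algebra of [X i], where freeness applies. *)
Lemma cpositive_sqrt a : cpositive a -> exists q r,
  [/\ self_adjoint q, r = q ^+ 2, r ^+ 2 = a, bicommuting a r
    & forall B, closed_subalgebra B -> B a -> B r].
Proof.
move=> pa; have [->|a0] := eqVneq a 0.
  by exists 0, 0; split; rewrite ?expr0n //; exact: cadj0.
have N0 : 0 < cnorm a by rewrite lt_neqAle cnorm_ge0 eq_sym cnorm_eq0 a0.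
set N := cnorm a in N0; pose w := (N^-1)%:C *: a.
have pw : cpositive w.
  have [b ab] := pa; exists ((Num.sqrt N^-1)%:C *: b).
  rewrite cadjZr -scalerAl -scalerAr scaler_real -expr2 sqr_sqrtr ?invr_ge0 ?(ltW N0) //.
  by rewrite -ab.
have w1 : cnorm w <= 1 by rewrite cnormZr ger0_norm ?invr_ge0 ?(ltW N0) // -/N mulVf ?gt_eqF.
have w1' := cnorm_one_sub_positive pw w1.
have sw := cpositive_self_adjoint pw.
have sw' : self_adjoint (1 - w) by apply: csaB => //; exact: csa1.
have [r0 [s0 r02 n0 c0 B0]] := sqrt_one_sub sw' w1'.
have s0' : self_adjoint (1 - r0) by apply: csaB => //; exact: csa1.
have [r1 [s1 r12 n1 c1 _]] := sqrt_one_sub s0' n0.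
have sN : 0 <= Num.sqrt N by exact: sqrtr_ge0.
exists ((Num.sqrt (Num.sqrt N))%:C *: r1), ((Num.sqrt N)%:C *: r0); split.
- exact: csaZ.
- by rewrite exprZn -rmorphXn sqr_sqrtr // r12 opprB addrC subrK.
- rewrite exprZn -rmorphXn sqr_sqrtr ?ltW // r02 opprB addrC subrK /w scaler_real.
  by rewrite mulfV ?gt_eqF // scalerC1.
- move=> y ya; apply: commZ; apply: c0; apply: commrB; first exact: commr1.
  exact: commZ.
move=> B HB Ba; apply: closed_subalgebraZ => //; apply: B0 => //.
by apply: closed_subalgebraB => //; [case: HB|exact: closed_subalgebraZ].
Qed.

(** [csqrt] picks some positive root; uniqueness transfers to it the properties of the constructed
    one. With d = c - s, d (c + s) = 0 makes the nonnegative traces of d c d and d s d sum to 0, and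
    faithfulness gives d = 0. *)
Lemma positive_sqrt_uniq a c s q : cpositive c -> c ^+ 2 = a ->
  self_adjoint q -> s = q ^+ 2 -> s ^+ 2 = a -> bicommuting a s -> c = s.
Proof.
move=> /[dup] pc /cpositive_square[e [se ec _]] ca sq sqE sa cs.
have comm_cs : GRing.comm c s.
  by apply: cs; rewrite -ca; apply: commrX.
pose d := c - s.
have ds : self_adjoint d.
  apply: csaB; first exact: cpositive_self_adjoint.
  by rewrite sqE; exact: csaX.
have d0 : d * (c + s) = 0.
  by rewrite mulrDr !mulrBl comm_cs addrA subrK -!expr2 ca sa subrr.
have dcsd : tau (adj (e * d) * (e * d)) + tau (adj (q * d) * (q * d)) = 0.
  rewrite !csquare_adj se sq ds -!expr2 ec -sqE -tauD -mulrDl -mulrDr d0.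
  by rewrite mul0r tau0.
have h1 := tau_square_ge0 (e * d); have h2 := tau_square_ge0 (q * d).
have ed : e * d = 0 by apply: tau_faithful; lra.
have qd : q * d = 0 by apply: tau_faithful; lra.
apply/eqP; rewrite -subr_eq0 -/d; apply/eqP; apply: tau_faithful_sq => //.
by rewrite expr2 {1}/d mulrBl -ec sqE !expr2 -!mulrA ed qd !mulr0 subrr tau0.
Qed.

Lemma csqrtP a : cpositive a -> exists q, [/\ self_adjoint q, csqrt a = q ^+ 2,
  csqrt a ^+ 2 = a, bicommuting a (csqrt a)
  & forall B, closed_subalgebra B -> B a -> B (csqrt a)].
Proof.
move=> pa; have [q [r [sq rq ra cr Br]]] := cpositive_sqrt pa.
have [pc ca] : cpositive (csqrt a) /\ csqrt a ^+ 2 = a.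
  rewrite /csqrt; case: xgetP => [b _ //|/(_ r) []]; split=> //.
  by rewrite rq; exact: cpositive_sq.
by exists q; rewrite (positive_sqrt_uniq pc ca sq rq ra cr).
Qed.

Lemma csqrt_self_adjoint a : cpositive a -> self_adjoint (csqrt a).
Proof. by move=> /csqrtP[q [sq -> _ _ _]]; exact: csaX. Qed.

Lemma csqrt_sqr a : cpositive a -> csqrt a ^+ 2 = a.
Proof. by move=> /csqrtP[q []]. Qed.

Lemma circ_positive a b : cpositive a -> cpositive b -> cpositive (circ a b).
Proof.
move=> /csqrt_self_adjoint sa [c ->]; exists (c * csqrt a).
by rewrite csquare_adj sa.
Qed.

(** For [a] nonzero, [1 - adj a * a / cnorm a ^+ 2] is the square of some self-adjoint [r], and
    [adj (r * b) * (r * b)] has nonnegative trace. *)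
Lemma tau_square_conj_le a b :
  tau (adj (a * b) * (a * b)) <= cnorm a ^+ 2 * tau (adj b * b).
Proof.
have [->|a0] := eqVneq a 0.
  by rewrite mul0r mulr0 tau0 mulr_ge0 ?sqr_ge0 // tau_square_ge0.
have N0 : 0 < cnorm a ^+ 2.
  by rewrite exprn_gt0 // lt_neqAle cnorm_ge0 eq_sym cnorm_eq0 a0.
set N := _ ^+ 2 in N0 *; pose w := (N^-1)%:C *: (adj a * a).
have w1 : cnorm w <= 1.
  rewrite cnormZr ger0_norm ?invr_ge0 ?(ltW N0) // cnorm_adj_mul -/N.
  by rewrite mulVf ?gt_eqF.
have sw : self_adjoint w by apply: csaZ; rewrite /self_adjoint adjM adjK.
have [r [sr r2 _ _ _]] := sqrt_one_sub sw w1.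
have := tau_square_ge0 (r * b); rewrite !csquare_adj sr -expr2 r2.
rewrite mulrBr mulrBl mulr1 tauB /w -scalerAr -scalerAl tauZ subr_ge0 mulrC.
by rewrite ler_pdivrMr // mulrC.
Qed.

Lemma tau_square_le a : tau (adj a * a) <= cnorm a ^+ 2.
Proof. by have := tau_square_conj_le a 1; rewrite !mulr1 cadj1 tau1 mulr1. Qed.

Lemma normE_le a : `|E a| <= (cnorm a)%:C.
Proof.
(* The variance of [a] is nonnegative, so |E a|^2 is at most the trace of [adj a * a]. *)
have : 0 <= E (adj (a - E a *: 1) * (a - E a *: 1)) by case: HE.
rewrite cadjB Defs.adjZ cadj1 mulrBl !mulrBr -!scalerAr -!scalerAl !mulr1 !mul1r.
rewrite !EB !EZ E1 mulr1 E_adj E_square -/(real_trace _) => h.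
have {}h : `|E a| ^+ 2 <= (tau (adj a * a))%:C.
  by rewrite normCK -subr_ge0; apply: etrans h; congr (_ <= _); ring.
rewrite -(@ler_pXn2r _ 2) ?nnegrE ?normr_ge0 ?ler0c ?cnorm_ge0 //.
by rewrite (le_trans h) // -rmorphXn lecR tau_square_le.
Qed.

Lemma tau_le a : tau a <= cnorm a.
Proof.
rewrite -lecR; apply: le_trans (normE_le a).
by apply: le_trans (normc_ge_Re _); rewrite lecR ler_norm.
Qed.

Lemma normtau_le a : `|tau a| <= cnorm a.
Proof.
rewrite ler_norml tau_le andbT lerNl -tauN.
by apply: le_trans (tau_le _) _; rewrite cnormN.
Qed.

Lemma E_limit u a z : climit u a -> (forall n, E (u n) = z) -> E a = z.
Proof.
move=> ua uz; apply/eqP; rewrite -subr_eq0 -normr_le0.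
have [r zr] : exists r : R, `|E a - z| = r%:C by rewrite normc_def; eexists.
rewrite zr lecR leNgt; apply/negP => /ua [N /(_ _ (leqnn N))].
rewrite -(ltcR (cnorm _)) -zr => /(le_lt_trans (normE_le _)).
by rewrite EB uz distrC ltxx.
Qed.

End FaithfulTrace.

(** * Operator norm from moment growth *)

Section NormBound.
Context {R : realType} {A : cstarAlgType R} (E : {scalar A}) (HE : prob_space E).
Implicit Types (a b x y p r : A).
Local Notation tau := (real_trace E).

Lemma geometric_domination (K K' T M : R) : 0 < K -> K < K' ->
  (forall k, K' ^+ k * T <= M * K ^+ k) -> T <= 0.
Proof.
move=> K0 KK H; rewrite leNgt; apply/negP => T0.
pose d := K' / K - 1.
have d0 : 0 < d by rewrite subr_gt0 ltr_pdivlMr // mul1r.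
have bern k : 1 + k%:R * d <= (K' / K) ^+ k.
  elim: k => [|k IH]; first by rewrite mul0r addr0 expr0.
  have Kd : K' / K = 1 + d by rewrite /d addrC subrK.
  rewrite Kd in IH *.
  have : 0 <= k%:R * d :> R by rewrite mulr_ge0 // ltW.
  rewrite exprS -natr1; move: IH; set e := _ ^+ k; set m := k%:R; nra.
have {}H k : (1 + k%:R * d) * T <= M.
  apply: (@le_trans _ _ ((K' / K) ^+ k * T)); first by rewrite ler_pM2r.
  by rewrite expr_div_n mulrAC ler_pdivrMr ?exprn_gt0.
have dT : 0 < d * T by rewrite mulr_gt0.
have := archi_boundP (normr_ge0 (M / (d * T))); set k := Num.bound _ => hk.
have := le_lt_trans (ler_norm _) hk; rewrite ltr_pdivrMr //.
by have := H k; set m := k%:R; lra.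
Qed.

(** Let [v] be the negative part of K' - y with K' > K. The moments of [y] weighted by [v ^+ 2] are
    at least of size K'^k and at most of size K^k, so [v] vanishes. Then y and K' - y are squares
    summing to K', which bounds the norm. *)
Lemma cnorm_le_moments y (C K : R) : cpositive y -> 0 < K ->
  (forall k, tau (y ^+ k) <= C * K ^+ k) -> cnorm y <= K.
Proof.
move=> py K0 H; apply/ler_addgt0Pr => e e0; set K' := K + e.
have [p [sp py2 _]] := cpositive_square HE py.
have sy : self_adjoint y by exact: cpositive_self_adjoint.
have sx : self_adjoint (K'%:C *: 1 - y) by apply: csaB => //; apply: csaZ; exact: csa1.
have [v [r [sv sr vx vr [rc vv]]]] := negative_part sx.
set x := _ - y in sx vx vr rc vv.
have yx : GRing.comm y x.
  by apply: commrB; [apply: commZ; exact: commr1|exact: commr_refl].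
have vE : v = (2^-1 : R)%:C *: (r ^+ 2 - x) by rewrite -vv scaler_half2.
have yv : GRing.comm y v.
  by rewrite vE; apply: commZ; apply: commrB => //; apply: commrX; apply: rc.
have vy : v * y = v ^+ 2 + K'%:C *: v.
  apply/eqP; rewrite -subr_eq -[X in _ == X]opprK -vx /x mulrBr opprB.
  by rewrite -scalerAr mulr1.
have v2y : v ^+ 2 * y = v * v ^+ 2 + K'%:C *: v ^+ 2.
  by rewrite {1}expr2 -mulrA vy mulrDr -scalerAr -expr2.
(* Multiplying [v ^+ 2] by [y] gives K' v^2 + v^3, and y^k v^3 has the trace of [adj c * c] for c =
   r v p^k. *)
have lower k : K' ^+ k * tau (v ^+ 2) <= tau (y ^+ k * v ^+ 2).
  elim: k => [|k IH]; first by rewrite !expr0 !mul1r.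
  rewrite (exprSr y) -mulrA (commrX 2 yv) v2y mulrDr -scalerAr.
  rewrite tauD tauZ (exprS K') -mulrA.
  apply: le_trans (ler_wpM2l _ IH) _; first by rewrite addr_ge0 // ltW.
  rewrite lerDr -py2 -exprM mulnC exprM (expr2 (p ^+ k)) -mulrA tau_trace // -exprS.
  have := tau_square_ge0 HE (r * v * p ^+ k).
  rewrite csquare_adj (csaX k sp) csquare_adj sr sv -expr2 vr.
  by rewrite -exprSr.
have upper k : tau (y ^+ k * v ^+ 2) <= cnorm v ^+ 2 * C * K ^+ k.
  rewrite -mulrA; apply: le_trans (ler_wpM2l (sqr_ge0 _) (H k)).
  have := tau_square_conj_le HE v (p ^+ k).
  rewrite csquare_adj (csaX k sp) sv -expr2 -(expr2 (p ^+ k)) -exprM mulnC exprM py2.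
   rewrite -mulrA tau_trace // -mulrA -expr2 -exprM mulnC exprM py2. 
  by rewrite tau_trace.
have tv : tau (v ^+ 2) <= 0.
  apply: (@geometric_domination K K' _ (cnorm v ^+ 2 * C)) => //.
    by rewrite /K'; lra.
  by move=> k; exact: le_trans (lower k) (upper k).
have v0 : v = 0.
  apply: (tau_faithful_sq HE) => //; apply/eqP.
  by rewrite eq_le tv tau_sq_ge0.
have rx : r ^+ 2 = x by apply/eqP; rewrite -subr_eq0 -vv v0 addr0.
rewrite -py2 cnorm_sq // -[leRHS](@ger0_norm _ K'); last by rewrite /K' addr_ge0 // ltW.
apply: (cnorm_of_sum_squares sp sr); last by rewrite rx /x py2 addrC subrK.
apply: rc; rewrite /x -py2; apply: commrB; first by apply: commZ; exact: commr1.
by apply: commrX; exact: commr_refl.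
Qed.

End NormBound.

(** * Alternating words and freeness *)

Section Words.
Context {R : realType} {A : cstarAlgType R} (E : {scalar A}) (HE : prob_space E).
Implicit Types (a b : A).

Definition norm_closure (B : A -> Prop) a :=
  forall e : R, 0 < e -> exists2 b, B b & cnorm (b - a) < e.

Definition unital_subspace (B : A -> Prop) :=
  B 1 /\ forall k a b, B a -> B b -> B (k *: a + b).

Definition mul_closed (B : A -> Prop) := forall a b, B a -> B b -> B (a * b).

Lemma subset_norm_closure B a : B a -> norm_closure B a.
Proof. by move=> Ba e e0; exists a; rewrite ?subrr ?cnorm0. Qed.

Lemma closure_seq B a : norm_closure B a -> exists2 u, forall n, B (u n) & climit u a.
Proof.
move=> H; have e0 n : 0 < 2 / n.+2%:R :> R by rewrite divr_gt0.
pose u n := projT1 (cid2 (H _ (e0 n))).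
exists u => [n|e /inv_small [N hN]]; first by rewrite /u; case: cid2.
exists N => n /hN; apply: lt_trans; rewrite /u; case: cid2 => //.
Qed.

Lemma climit_closure B u a : (forall n, norm_closure B (u n)) -> climit u a -> norm_closure B a.
Proof.
move=> Bu ua e e0; have e2 : 0 < e / 2 by lra.
have [N /(_ _ (leqnn N)) hN] := ua _ e2; have [b Bb hb] := Bu N _ e2.
exists b => //; have := cnormD (b - u N) (u N - a); rewrite addrA subrK; lra.
Qed.

Lemma climit_in_closure B u a : (forall n, B (u n)) -> climit u a -> norm_closure B a.
Proof. by move=> Bu; apply: climit_closure => n; exact: subset_norm_closure. Qed.

Lemma unital_subspace_closure B : unital_subspace B -> unital_subspace (norm_closure B).
Proof.
move=> [B1 Bl]; split=> [|k a b /closure_seq[u Bu ua] /closure_seq[v Bv vb]].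
  exact: subset_norm_closure.
apply: (@climit_in_closure B (fun n => k *: u n + v n)) => [n|]; first exact: Bl.
by apply: climitD => //; exact: climitZ.
Qed.

Lemma mul_closed_closure B : mul_closed B -> mul_closed (norm_closure B).
Proof.
move=> BM a b /closure_seq[u Bu ua] /closure_seq[v Bv vb].
apply: (@climit_closure _ (fun n => u n * b)); last exact: climitMr.
move=> n; apply: (@climit_in_closure B (fun m => u n * v m)); last exact: climitMl.
by move=> m; exact: BM.
Qed.

Lemma closed_subalgebra_closure B : unital_subspace B -> mul_closed B ->
  closed_subalgebra (norm_closure B).
Proof.
move=> /unital_subspace_closure[B1 Bl] /mul_closed_closure BM; split=> // u a.
exact: climit_closure.
Qed.

Section Letters.
Variables (I : eqType).
Implicit Types (s w pre : seq (I * A)) (i j : I) (B : I -> A -> Prop).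

Definition wprod s : A := \prod_(x <- s) x.2.

Fixpoint centered_letters B s : Prop :=
  if s is x :: s' then [/\ B x.1 x.2, E x.2 = 0 & centered_letters B s'] else True.

Definition alternating (l : seq I) := sorted (fun i j => i != j) l.

Lemma wprod_cons x s : wprod (x :: s) = x.2 * wprod s.
Proof. exact: big_cons. Qed.

Lemma wprod_nil : wprod [::] = 1.
Proof. exact: big_nil. Qed.

Lemma wprod_letter i a : wprod [:: (i, a)] = a.
Proof. by rewrite wprod_cons wprod_nil mulr1. Qed.

Lemma wprod_cat s w : wprod (s ++ w) = wprod s * wprod w.
Proof. exact: big_cat. Qed.

Lemma centered_letters_cat B s w :
  centered_letters B (s ++ w) <-> centered_letters B s /\ centered_letters B w.
Proof.
elim: s => [|x s IH] /=; first by split=> [|[]].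
split=> [[? ? /IH[? ?]]|[[? ? ?] ?]]; split=> //; exact/IH.
Qed.

Lemma centered_letters_nth B s (x0 : I * A) n : centered_letters B s -> (n < size s)%N ->
  B (nth x0 s n).1 (nth x0 s n).2 /\ E (nth x0 s n).2 = 0.
Proof. by elim: s n => [//|x s IH] [|n] /= [? ? /IH H] // /H. Qed.

(* Letters are replaced by their approximants one at a time, from left to right. *)
Lemma words_closure B (ok : seq I -> Prop) : (forall i, unital_subspace (B i)) ->
  (forall s, centered_letters B s -> ok (unzip1 s) -> E (wprod s) = 0) ->
  forall s, centered_letters (fun i => norm_closure (B i)) s -> ok (unzip1 s) ->
  E (wprod s) = 0.
Proof.
move=> Bs H s; have nilB : centered_letters B [::] by [].
rewrite -[s]cat0s; elim: s [::] nilB => [|[i a] s IH] pre preB.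
  by rewrite cats0 => _; exact: H.
rewrite centered_letters_cat /= => -[_ [/closure_seq[u Bu ua] a0 sB]] oks.
have [B1 Bl] := Bs i.
(* Approximants of a centered letter need not be centered; subtracting their means repairs this and
   keeps the limit, as [E] is contractive. *)
pose v n := u n - E (u n) *: 1.
have va : climit v a.
  have vE n : v n - a = (u n - a) - E (u n - a) *: 1.
    by rewrite /v EB a0 subr0 addrAC.
  move=> e e0; have e2 : 0 < e / 2 by lra.
  have [N hN] := ua _ e2.
  exists N => n /hN un; rewrite vE; apply: le_lt_trans (cnormB _ _) _.
  have : cnorm (E (u n - a) *: (1 : A)) <= cnorm (u n - a).
    by rewrite -lecR cnormZ cnorm1 rmorph1 mulr1 normE_le.
  by lra.
have lim : climit (fun n => wprod pre * v n * wprod s) (wprod pre * a * wprod s).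
  by apply: climitMr; apply: climitMl.
rewrite wprod_cat wprod_cons mulrA; apply: (E_limit HE lim) => n.
have := IH (rcons pre (i, v n)); rewrite -cats1 -catA /= => {}IH.
rewrite -mulrA -[v n]/((i, v n).2) -wprod_cons -wprod_cat; apply: IH.
- rewrite centered_letters_cat; split=> //=; split=> //.
    by rewrite /v addrC -scaleNr; apply: (Bl).
  by rewrite /v EB EZ (E1 HE) mulr1 subrr.
- rewrite centered_letters_cat; split.
    move: preB; elim: (pre) => [//|x p IHp] /= [? ? ?]; split=> //; last exact: IHp.
    exact: subset_norm_closure.
  split=> //=.
    by apply: subset_norm_closure; rewrite /v addrC -scaleNr; apply: (Bl).
  by rewrite /v EB EZ (E1 HE) mulr1 subrr.
by move: oks; rewrite /unzip1 !map_cat.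
Qed.

Definition cyclically_alternating (l : seq I) :=
  if l is i :: l' then alternating l && (last i l' != i) else false.

Definition cyclically_free B := forall s, centered_letters B s ->
  cyclically_alternating (unzip1 s) -> E (wprod s) = 0.

Definition freely_alternating B := forall s, centered_letters B s ->
  (s != [::]) && alternating (unzip1 s) -> E (wprod s) = 0.

(* If the end letters [x], [y] carry the same index, the trace allows to merge
   them into [y x] and to split off the mean of this product. *)
Lemma cyclically_free_alternating B : (forall i, unital_subspace (B i)) ->
  (forall i, mul_closed (B i)) -> cyclically_free B -> freely_alternating B.
Proof.
move=> Bs BM cyc s; have [n] := ubnP (size s); elim: n s => // n IH [//|[i a] s].
rewrite ltnS => sn sB alt.
have [eqi|nei] := eqVneq (last i (unzip1 s)) i; last first.
  by apply: cyc => //; move: alt => /= ->.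
case/lastP: s eqi sn sB alt => [|m [j b]] /=.
  by move=> _ _ [_ a0 _] _; rewrite wprod_cons wprod_nil mulr1.
rewrite /unzip1 map_rcons last_rcons /= => ->.
rewrite size_rcons -cats1 => mn [Ba a0 /centered_letters_cat[mB [/= Bb b0 _]]].
rewrite wprod_cons wprod_cat wprod_cons wprod_nil mulr1 /=.
rewrite E_trace // -mulrA.
case: m mn mB => [|[k c] m] mn mB; first by rewrite /= eqxx.
rewrite rcons_path => /andP[alt lasti].
have [B1 Bl] := Bs i.
rewrite -(subrK (E (b * a) *: 1) (b * a)) mulrDr ED // E_trace // -scalerAr EZ.
rewrite mulr1 (IH ((k, c) :: m)) //; first last.
- by case/andP: alt.
- exact: ltn_trans mn.
rewrite mulr0 addr0.
have := cyc ((i, b * a - E (b * a) *: 1) :: (k, c) :: m).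
rewrite (wprod_cons (i, _)); apply.
  split=> //=; last by rewrite EB EZ (E1 HE) mulr1 subrr.
  by rewrite addrC -scaleNr; apply: (Bl) => //; exact: BM.
by apply/andP; split; [exact: alt|exact: lasti].
Qed.

Inductive word_span B (J : pred I) : A -> Prop :=
| word_span0 : word_span B J 0
| word_spanD k w a : centered_letters B w -> (w != [::]) && alternating (unzip1 w) ->
    all J (unzip1 w) -> word_span B J a -> word_span B J (k *: wprod w + a).

(** Normal form for the algebra generated by the [B i] with [i] in [J]: for a free family [c] is the
    mean, since [E] vanishes on the words. *)
Definition free_product B J a := exists c, word_span B J (a - c *: 1).

Section Grouping.
Variables (B : I -> A -> Prop) (J : pred I).
Hypotheses (Bs : forall i, unital_subspace (B i)) (BM : forall i, mul_closed (B i))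
  (Bfree : freely_alternating B).

Lemma word_span_lin k a b : word_span B J a -> word_span B J b ->
  word_span B J (k *: a + b).
Proof.
move=> + Jb; elim=> [|l w c wB w0 Jw _ IH]; first by rewrite scaler0 add0r.
by rewrite scalerDr -addrA scalerA; exact: word_spanD.
Qed.

Lemma word_span_E a : word_span B J a -> E a = 0.
Proof.
elim=> [|k w c wB w0 _ _ IH]; first exact: linear0.
by rewrite ED EZ IH Bfree // mulr0 addr0.
Qed.

Lemma free_product_lin : unital_subspace (free_product B J).
Proof.
split=> [|k a b [c Ja] [d Jb]].
  by exists 1; rewrite scale1r subrr; exact: word_span0.
exists (k * c + d).
rewrite (_ : _ - _ = k *: (a - c *: 1) + (b - d *: 1)); first exact: word_span_lin.
by rewrite scalerBr scalerA scalerDl opprD addrACA.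
Qed.

(** A letter meeting a word either merges with a first letter of the same index or is put in front;
    in both cases the mean removed by recentring multiplies a word again. *)
Lemma free_product_mul i a b : J i -> B i a -> free_product B J b ->
  free_product B J (a * b).
Proof.
move=> Ji Ba [c Jb]; have [Q1 Ql] := free_product_lin.
have letterJ a' : B i a' -> free_product B J a'.
  move=> Ba'; exists (E a').
  rewrite -[a' - _]addr0 -[a' - _]scale1r.
  rewrite -(wprod_letter i (a' - _)).
  apply: word_spanD => //=; [|by rewrite Ji|exact: word_span0].
  have [B1 Bl] := Bs i.
  split=> //; first by rewrite addrC -scaleNr; apply: (Bl).
  by rewrite EB EZ (E1 HE) mulr1 subrr.
suff mulJ d : word_span B J d -> free_product B J (a * d).
  rewrite -(subrK (c *: 1) b) mulrDr -scalerAr mulr1 addrC.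
  by apply: (Ql); [exact: letterJ|exact: mulJ].
elim=> [|k w {}b' wB w0 Jw _ IH].
  by rewrite mulr0 -(subrr 1) addrC -scaleN1r; apply: (Ql).
rewrite mulrDr -scalerAr; apply: (Ql) => //.
case: w wB w0 Jw => [//|[j x] w] /= [Bx x0 wB] alt /andP[Jj Jw].
have wordJ w' : centered_letters B w' -> alternating (unzip1 w') ->
    all J (unzip1 w') -> free_product B J (wprod w').
  case: w' => [|y w'] *; first by rewrite wprod_nil.
  exists 0; rewrite scale0r subr0 -[wprod _]addr0 -[wprod _]scale1r.
  by apply: word_spanD => //; exact: word_span0.
have [B1 Bl] := Bs i.
have [ij|nij] := eqVneq i j.
  rewrite wprod_cons /= mulrA -(subrK (E (a * x) *: 1) (a * x)) mulrDl addrC.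
  rewrite -scalerAl mul1r; apply: (Ql).
    by apply: wordJ => //; exact: path_sorted alt.
  rewrite -[_ - _]/((i, a * x - E (a * x) *: 1).2) -wprod_cons.
  apply: wordJ => //=.
  - split=> //; last by rewrite EB EZ (E1 HE) mulr1 subrr.
    by rewrite addrC -scaleNr; apply: (Bl) => //; apply: BM => //; rewrite ij.
  - by rewrite ij.
  - by rewrite Ji.
rewrite -[a in a * _](subrK (E a *: 1)) mulrDl addrC -scalerAl mul1r; apply: (Ql).
  by apply: wordJ => //=; rewrite Jj.
rewrite -[_ - _]/((i, a - E a *: 1).2) -wprod_cons.
apply: wordJ => /=; [|by rewrite nij|by rewrite Ji Jj].
split=> //; last by rewrite EB EZ (E1 HE) mulr1 subrr.
by rewrite addrC -scaleNr; apply: (Bl).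
Qed.

End Grouping.

End Letters.

(** Letters from the free product expand into centered words over [J]; as [i0] is not in [J], these
    join with the letters of index [i0] to alternating words of the original family. *)
Lemma grouped_words (I : eqType) (B : I -> A -> Prop) (J : pred I) (i0 : I) :
  freely_alternating B -> ~~ J i0 ->
  freely_alternating (fun b : bool => if b then B i0 else free_product B J).
Proof.
move=> Bfree Ji0.
pose F (b : bool) := if b then B i0 else free_product B J.
pose ok (b : bool) i := if b then i == i0 else J i.
(* [pre] is the part already expanded; the conditional hypothesis lets it be followed by any index
   that the next letter can begin with. *)
suff H (s : seq (bool * A)) (pre : seq (I * A)) : centered_letters B pre ->
    alternating (unzip1 pre) -> (s != [::]) || (pre != [::]) ->
    (if s is x :: _ then forall i, ok x.1 i -> alternating (rcons (unzip1 pre) i) else True) ->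
    centered_letters F s -> alternating (unzip1 s) -> E (wprod pre * wprod s) = 0.
  move=> s sF /andP[s0 alt]; rewrite -[wprod s]mul1r.
  rewrite -[X in X * _](@wprod_nil I); apply: H => //; first by rewrite s0.
  by case: (s).
elim: s pre => [|[[] a] s IH] pre preB preA.
- by move=> pre0 _ _ _; rewrite wprod_nil mulr1; apply: Bfree => //; rewrite preA andbT.
- move=> _ glue /= [Ba a0 sF] alt.
  rewrite wprod_cons mulrA -[X in wprod pre * X](wprod_letter i0) -wprod_cat.
  have altpre : alternating (rcons (unzip1 pre) i0) by apply: glue; rewrite /= eqxx.
  apply: IH => //; last exact: path_sorted alt.
  + by rewrite centered_letters_cat.
  + by rewrite cats1 /unzip1 map_rcons.
  + by rewrite orbC; case: (pre).
  case: s alt {sF} => [//|[[] c] s] //= _ i Ji.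
  rewrite /unzip1 map_cat /= cats1 /alternating -cats1 -cats1 -catA /= sorted_cat_cons.
  move: altpre; rewrite /alternating /unzip1 => -> /=; rewrite andbT.
  by apply: contraNneq Ji0 => ->; exact: Ji.
move=> _ glue /= [[c Ja] a0 sF] alt.
(* A centered letter has no scalar part, so its expansion contains only nonempty words, which keep
   neighbours of index [i0] apart. *)
have c0 : c = 0.
  have := word_span_E Bfree Ja; rewrite EB a0 EZ (E1 HE) mulr1 sub0r.
  by move/eqP; rewrite oppr_eq0 => /eqP.
move: Ja; rewrite c0 scale0r subr0 wprod_cons /= => {c0 c a0}.
elim=> [|k w b wB w0 Jw _ IHb]; first by rewrite mul0r mulr0; exact: linear0.
rewrite mulrDl mulrDr -scalerAl -scalerAr ED EZ IHb addr0 mulrA -wprod_cat.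
rewrite IH ?mulr0 //; last exact: path_sorted alt.
- by rewrite centered_letters_cat.
- case: w w0 Jw {wB} => [//|[i x] w] /= alt' /andP[Ji Jw].
  rewrite /unzip1 map_cat /= /alternating sorted_cat_cons; apply/andP; split=> //.
  exact: glue.
- by rewrite orbC; case: (w) w0; rewrite // => ? ? _; case: (pre).
case: s alt {sF IH IHb} => [//|[[] d] s] //= _ i /eqP ->{i}.
case/lastP: w w0 Jw {wB} => [//|w [i x]] w0 Jw.
move: w0 Jw; rewrite /unzip1 map_cat map_rcons all_rcons /= => /andP[_ altw] /andP[Ji Jw].
have ii0 : i != i0 by apply: contraNneq Ji0 => <-.
rewrite -cats1 -catA cat_rcons /alternating catA sorted_cat_cons /= ii0 /= andbT.
case: w altw Jw => [|[j y] w] /= altw Jw; first by rewrite cats0; exact: glue.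
case/andP: Jw => Jj Jw.
by rewrite rcons_cat /= sorted_cat_cons; apply/andP; split=> //; exact: glue.
Qed.

End Words.

(** * From the given freeness to closed algebras *)

Section FreeVariables.
Context {R : realType} {A : cstarAlgType R} (E : {scalar A}) (HE : prob_space E).
Implicit Types (a b : A).

Lemma generated_unital_subspace (S : set A) : unital_subspace (generated_subalgebra S).
Proof.
split=> [C [[C1 _ _] _]|k a b Ba Bb C HC].
  by rewrite inE in C1.
have Ca := Ba _ HC; have Cb := Bb _ HC; case: HC => [[_ Cl _] _].
by have := Cl k a b; rewrite !inE; apply.
Qed.

Lemma generated_mul_closed (S : set A) : mul_closed (generated_subalgebra S).
Proof.
move=> a b Ba Bb C HC.
have Ca := Ba _ HC; have Cb := Bb _ HC; case: HC => [[_ _ CM] _].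
by have := CM a b; rewrite !inE; apply.
Qed.

Lemma generated_mem (S : set A) a : S a -> generated_subalgebra S a.
Proof. by move=> Sa C [_ SC]; exact: SC. Qed.

Lemma free_cyclically (I : eqType) (B : I -> A -> Prop) :
  free_subalgebras E B -> cyclically_free E B.
Proof.
move=> HB [|[i a] s] // sB /andP[alt lasti].
pose w := (i, a) :: s.
pose k (j : 'I_(size s).+1) := (nth (i, a) w j).1.
pose c (j : 'I_(size s).+1) := (nth (i, a) w j).2.
have := HB (size s) k c; rewrite /wprod (big_nth (i, a)) big_mkord; apply.
- by move=> j; have [] := centered_letters_nth (i, a) sB (ltn_ord j).
- by move=> j; have [] := centered_letters_nth (i, a) sB (ltn_ord j).
- move=> j j' jj'; rewrite /k jj' => e.
  have lj : (j < size s)%N by have := ltn_ord j'; rewrite jj' ltnS.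
  have /(sortedP i) := alt => /(_ j); rewrite /= size_map ltnS => /(_ lj).
  have := nth_map (i, a) i fst; move=> nm.
  by rewrite -[i :: _]/(unzip1 w) !nm ?e ?eqxx //= ltnS; exact: ltnW.
move=> e; move: lasti; rewrite /= (last_nth i) size_map.
rewrite -[i :: _]/(unzip1 w) (nth_map (i, a)) //.
by move: e; rewrite /k /= => ->; rewrite eqxx.
Qed.

Section Family.
Context (I : eqType) (X : I -> A) (HX : free_variables E X).

(** The closure is taken because square roots and resolvents of [X i] are norm limits of polynomials
    in it. *)
Definition closed_algebra_of i := norm_closure (generated_subalgebra [set X i]%classic).

Lemma closed_algebra_ofP i : closed_subalgebra (closed_algebra_of i).
Proof.
apply: closed_subalgebra_closure; first exact: generated_unital_subspace.
exact: generated_mul_closed.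
Qed.

Lemma closed_algebra_of_mem i : closed_algebra_of i (X i).
Proof. by apply: subset_norm_closure; exact: generated_mem. Qed.

Lemma closed_algebras_free : freely_alternating E closed_algebra_of.
Proof.
apply: cyclically_free_alternating => //.
- move=> i; apply: unital_subspace_closure; exact: generated_unital_subspace.
- move=> i; apply: mul_closed_closure; exact: generated_mul_closed.
move=> s; apply: (words_closure HE (B := fun i => generated_subalgebra [set X i]%classic)
  (ok := @cyclically_alternating I)).
  by move=> i; exact: generated_unital_subspace.
exact: free_cyclically.
Qed.

Definition complementary_algebra (J : pred I) := norm_closure (free_product E closed_algebra_of J).

(** Used with [J] the indices of the remaining product, so that one variable is free from that
    product and its resolvents. *)
Lemma free_pair (i0 : I) (J : pred I) : ~~ J i0 ->
  freely_alternating E (fun b : bool =>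
    if b then closed_algebra_of i0 else complementary_algebra J).
Proof.
move=> Ji0 s sB salt.
pose F (b : bool) := if b then closed_algebra_of i0 else free_product E closed_algebra_of J.
apply: (words_closure HE (B := F) (ok := fun l => (l != [::]) && alternating l)).
- case; last exact: free_product_lin.
  by have [B1 Bl _ _] := closed_algebra_ofP i0.
- move=> w wB walt; have := grouped_words HE closed_algebras_free Ji0 wB; apply.
  by move: walt; case: w {wB}.
- elim: s sB {salt} => [|[[] a] s IH] //= [Ba a0 /IH sB]; split=> //.
  exact: subset_norm_closure.
by move: salt; case: s {sB}.
Qed.

(** Powers of a product are reached by multiplying 1 from the left by its factors; this replaces
    closure of the free product under multiplication. *)
Definition multiplier (J : pred I) z := forall b,
  free_product E closed_algebra_of J b -> free_product E closed_algebra_of J (z * b).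

Lemma multiplier_letter (J : pred I) i a : J i -> closed_algebra_of i a -> multiplier J a.
Proof.
move=> Ji Ba b; apply: (free_product_mul HE _ _ Ji Ba) => j.
  by have [B1 Bl _ _] := closed_algebra_ofP j.
by have [] := closed_algebra_ofP j.
Qed.

Lemma multiplierM (J : pred I) a b : multiplier J a -> multiplier J b -> multiplier J (a * b).
Proof. by move=> Ja Jb c Jc; rewrite -mulrA; apply: Ja; exact: Jb. Qed.

Lemma multiplier_pow (J : pred I) z k : multiplier J z ->
  free_product E closed_algebra_of J (z ^+ k).
Proof.
move=> Jz; elim: k => [|k IH]; last by rewrite exprS; exact: Jz.
by rewrite expr0; have [] := free_product_lin E closed_algebra_of J.
Qed.

End Family.

End FreeVariables.

(** * Resolvents of free products *)

Section Resolvents.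
Context {R : realType} {A : cstarAlgType R} (E : {scalar A}) (HE : prob_space E).
Implicit Types (a b : A) (k c e : R[i]).

Definition inverses a b := a * b = 1 /\ b * a = 1.

Lemma inverses_uniq a b d : inverses a d -> inverses b d -> a = b.
Proof. by move=> [ad _] [_ db]; rewrite -[a]mulr1 -db mulrA ad mul1r. Qed.

Fixpoint alternating_word a b (i : bool) n : seq (bool * A) :=
  if n is n'.+1 then (i, if i then a else b) :: alternating_word a b (~~ i) n' else [::].

Lemma wprod_alternating a b n : wprod (alternating_word a b false n.*2) = (b * a) ^+ n.
Proof.
elim: n => [|n IH]; first by rewrite wprod_nil.
by rewrite doubleS !wprod_cons IH exprS mulrA.
Qed.

Lemma wprod_alternatingr a b n :
  wprod (alternating_word a b false n.*2.+1) = (b * a) ^+ n * b.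
Proof.
elim: n => [|n IH]; first by rewrite wprod_cons wprod_nil mulr1 mul1r.
by rewrite doubleS !wprod_cons -wprod_cons IH exprS !mulrA.
Qed.

Section AlternatingFree.
Variables (F : bool -> A -> Prop) (al be : A).
Hypotheses (Ffree : freely_alternating E F)
  (Fal : F true al) (Fbe : F false be) (al0 : E al = 0) (be0 : E be = 0).

Lemma alternating_word_E i n : E (wprod (alternating_word al be i n.+1)) = 0.
Proof.
have letters m j : centered_letters E F (alternating_word al be j m).
  by elim: m j => [//|m IH] [] /=; split.
have alt m j : path (fun x y : bool => x != y) j (unzip1 (alternating_word al be (~~ j) m)).
  by elim: m j => [//|m IH] j /=; have := IH (~~ j); rewrite negbK => ->; case: j.
by apply: Ffree; [exact: letters|exact: alt].
Qed.

Lemma free_powers_E n : E ((1 - al) * (be * al) ^+ n * (1 - be)) = (n == 0%N)%:R.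
Proof.
have h1 : E ((be * al) ^+ n) = (n == 0%N)%:R.
  by case: n => [|n]; [rewrite expr0 E1|rewrite -wprod_alternating alternating_word_E].
have h2 : E (al * (be * al) ^+ n) = 0.
  rewrite -wprod_alternating.
  by have := alternating_word_E true n.*2; rewrite wprod_cons.
have h3 : E ((be * al) ^+ n * be) = 0.
  by rewrite -wprod_alternatingr alternating_word_E.
have h4 : E (al * (be * al) ^+ n * be) = 0.
  rewrite -mulrA -wprod_alternatingr.
  by have := alternating_word_E true n.*2.+1; rewrite wprod_cons.
by rewrite mulrBr mulr1 !mulrBl !mul1r !EB h1 h2 h3 h4 !subr0.
Qed.

(** In the Neumann series for [N], every term past the zeroth expands into alternating centered
    words and has trace 0. *)
Lemma free_neumann_E c N : cnorm (c *: (be * al)) < 1 -> inverses N (1 - c *: (be * al)) ->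
  E ((1 - al) * N * (1 - be)) = 1.
Proof.
move=> small Ninv; have [N' [limN N1 N2]] := neumann_exists small.
have -> : N = N' by apply: inverses_uniq Ninv _.
have lim := climitMr (1 - be) (climitMl (1 - al) (climit_sub (s := S) (@leqnSn) limN)).
apply: (E_limit HE lim) => n /=.
rewrite mulr_sumr mulr_suml E_sum big_ord_recl /= expr0 big1.
  by rewrite addr0 -[X in _ * X * _](expr0 (be * al)) free_powers_E.
move=> i _; rewrite /= exprZn -scalerAr -scalerAl [LHS]EZ free_powers_E.
by rewrite mulr0.
Qed.

End AlternatingFree.

(* With [p = 1 - w2 z], [q = 1 - w1 x] one has [p * be = p - e] and
   [al * q = q - e], which turns [1 - w z x] into [p (1 - c be al) q / e]. *)
Lemma resolvent_factorization x z al be (p q : A) e w1 w2 : e != 1 ->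
  p = 1 - w2 *: z -> q = 1 - w1 *: x -> p * be = p - e *: 1 -> al * q = q - e *: 1 ->
  p * (1 - (1 - e)^-1 *: (be * al)) * q = e *: (1 - (w1 * w2 / (1 - e)) *: (z * x)).
Proof.
move=> e1 pE qE pbe alq.
have f0 : 1 - e != 0 by rewrite subr_eq0 eq_sym.
pose u := w1 *: x; pose v := w2 *: z; pose f := 1 - e.
have vu : v * u = (w1 * w2) *: (z * x) by rewrite -scalerAl -scalerAr scalerA mulrC.
rewrite mulrBr mulr1 mulrBl -scalerAr -scalerAl mulrA -(mulrA (p * be)) pbe alq.
have -> : p - e *: 1 = f *: 1 - v by rewrite pE scalerBl scale1r addrAC.
have -> : q - e *: 1 = f *: 1 - u by rewrite qE scalerBl scale1r addrAC.
have -> : f^-1 *: ((f *: 1 - v) * (f *: 1 - u)) = f *: 1 - v - u + f^-1 *: (v * u).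
  rewrite mulrBr -scalerAr mulr1 scalerBr scalerA mulVf // scale1r.
  rewrite mulrBl -scalerAl mul1r [f^-1 *: (_ - v * u)]scalerBr scalerA mulVf // scale1r.
  by rewrite opprB addrA addrAC.
have -> : p * q = 1 - v - u + v * u.
  by rewrite pE qE mulrBr mulr1 mulrBl mul1r opprB addrA addrAC.
have zmodE (a g k d w : A) : (a + k + d) - (g + k + w) = (a - g) + (d - w).
  by rewrite !opprD addrACA (addrACA a) subrr addr0.
rewrite -!(addrA _ (- v)) zmodE.
rewrite scalerBr scalerA; congr (_ + _).
  by rewrite scalerBl scale1r opprB addrC subrK.
rewrite -{1}(scale1r (v * u)) -scalerBl vu scalerA -scaleNr.
by congr (_ *: _); rewrite /f; field.
Qed.

Lemma free_product_resolvent (F : bool -> A -> Prop) x z Ax Bz e w1 w2 :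
  freely_alternating E F -> e != 0 -> e != 1 ->
  inverses Ax (1 - w1 *: x) -> inverses Bz (1 - w2 *: z) ->
  E Ax = e^-1 -> E Bz = e^-1 -> F true (1 - e *: Ax) -> F false (1 - e *: Bz) ->
  cnorm ((1 - e)^-1 *: ((1 - e *: Bz) * (1 - e *: Ax))) < 1 ->
  exists2 G, inverses G (1 - (w1 * w2 / (1 - e)) *: (z * x)) & E G = e^-1.
Proof.
move=> Ffree e0 e1 [Axl Axr] [Bzl Bzr] EA EB' FA FB small.
have [N [_ N1 N2]] := neumann_exists small.
have := free_neumann_E Ffree FA FB _ _ small (conj N1 N2).
rewrite !EB !EZ EA EB' E1 // mulfV // subrr => /(_ erefl erefl) EN.
rewrite !opprB ![1 + _]addrC !subrK -scalerAl -scalerAr -scalerAl scalerA in EN.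
have pB : (1 - w2 *: z) * (1 - e *: Bz) = 1 - w2 *: z - e *: 1.
  by rewrite mulrBr mulr1 -scalerAr Bzr.
have Aq : (1 - e *: Ax) * (1 - w1 *: x) = 1 - w1 *: x - e *: 1.
  by rewrite mulrBl mul1r -scalerAl Axl.
have fact := resolvent_factorization e1 erefl erefl pB Aq.
(* The inverse read off from the factorization; [EN] says that e^2 times the trace of [Ax * N * Bz]
   is 1. *)
exists (e *: (Ax * N * Bz)); last first.
  apply: (mulfI e0); rewrite -EZ scalerA EN mulfV //.
have f1 : Ax * N * Bz * (e *: (1 - (w1 * w2 / (1 - e)) *: (z * x))) = 1.
  by rewrite -fact !mulrA -(mulrA _ Bz) Bzl mulr1 -(mulrA _ N) N1 mulr1 Axl.
have f2 : (e *: (1 - (w1 * w2 / (1 - e)) *: (z * x))) * (Ax * N * Bz) = 1.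
  by rewrite -fact !mulrA -(mulrA _ _ Ax) Axr mulr1 -(mulrA _ _ N) N2 mulr1 Bzr.
move: f1 f2; set K := 1 - _; set G := _ * Bz => f1 f2.
by split; [rewrite -scalerAl scalerAr|rewrite -scalerAr scalerAl].
Qed.

(** The identity (1 - w s z s)^-1 = 1 + w s (1 - w z s s)^-1 z s; with s the root of X it passes
    from Z X to X o Z. *)
Lemma conj_resolvent s z w G : inverses G (1 - w *: (z * (s * s))) ->
  exists2 H, inverses H (1 - w *: (s * z * s)) & E H = E G.
Proof.
move=> [Gl Gr].
have Gl' : w *: (G * z * s * s) = G - 1.
  by rewrite -Gl mulrBr mulr1 -scalerAr !mulrA opprB addrC subrK.
have Gr' : w *: (z * s * s * G) = G - 1.
  by rewrite -Gr mulrBl mul1r -scalerAl !mulrA opprB addrC subrK.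
exists (1 + w *: (s * G * z * s)); last first.
  by rewrite ED E1 // EZ -!mulrA E_trace // !mulrA -EZ Gl' EB E1 // addrC subrK.
have e1 : (w *: (s * G * z * s)) * (w *: (s * z * s)) = w *: (s * (G - 1) * z * s).
  by rewrite -Gl' -!scalerAr -!scalerAl !mulrA.
have e2 : (w *: (s * z * s)) * (w *: (s * G * z * s)) = w *: (s * (G - 1) * z * s).
  by rewrite -Gr' -!scalerAr -!scalerAl !mulrA.
have e3 : w *: (s * G * z * s) - w *: (s * (G - 1) * z * s) = w *: (s * z * s).
  by rewrite mulrBr !mulrBl mulr1 -scalerBr opprB addrC subrK.
split.
  rewrite mulrBr mulr1 mulrDl mul1r e1 opprD addrA addrAC -(addrA 1) e3.
  by rewrite addrK.
by rewrite mulrDr mulr1 mulrBl mul1r e2 e3 subrK.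
Qed.

End Resolvents.

(** * Asymptotic inversion *)

Section Asymptotics.
Context {R : realType}.
Implicit Types (f g : R -> R) (p q : {poly R}) (t z C : R).

(** Germs at 0 from the right. The threshold [d] is existential because only coefficients of
    asymptotic expansions are extracted in the end. *)
Definition near0 (P : R -> Prop) := exists2 d : R, 0 < d & forall t, 0 < t < d -> P t.

Lemma near0_lt (d : R) : 0 < d -> near0 (fun t => 0 < t < d).
Proof. by exists d. Qed.

Lemma near0I P Q : near0 P -> near0 Q -> near0 (fun t => P t /\ Q t).
Proof.
move=> [d d0 Pd] [e e0 Qe]; exists (Num.min d e); first by rewrite lt_min d0 e0.
by move=> t /andP[t0]; rewrite lt_min => /andP[td te]; split; [apply: Pd|apply: Qe];
  rewrite t0.
Qed.

Lemma near0_imp (P Q : R -> Prop) : (forall t, P t -> Q t) -> near0 P -> near0 Q.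
Proof. by move=> PQ [d d0 Pd]; exists d => // t /Pd /PQ. Qed.

Definition bigO N f := exists C, near0 (fun t => `|f t| <= C * t ^+ N).

Lemma bigO_ge0 N f : bigO N f -> exists2 C, 0 <= C & near0 (fun t => `|f t| <= C * t ^+ N).
Proof.
move=> [C [d d0 H]]; exists `|C| => //; exists d => // t td; apply: le_trans (H _ td) _.
by rewrite ler_wpM2r ?ler_norm // exprn_ge0 // ltW //; case/andP: td.
Qed.

Lemma bigO_near N f g : near0 (fun t => f t = g t) -> bigO N f -> bigO N g.
Proof.
by move=> fg [C H]; exists C; apply: near0_imp (near0I fg H) => t [<-].
Qed.

Lemma bigO_ext N f g : (forall t, f t = g t) -> bigO N f -> bigO N g.
Proof. by move=> fg; apply: bigO_near; exists 1 => // t _. Qed.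

Lemma bigOD N f g : bigO N f -> bigO N g -> bigO N (fun t => f t + g t).
Proof.
move=> [C H] [D K]; exists (C + D); apply: near0_imp (near0I H K) => t [h k].
by rewrite mulrDl (le_trans (ler_normD _ _)) // lerD.
Qed.

Lemma bigON N f : bigO N f -> bigO N (fun t => - f t).
Proof. by move=> [C H]; exists C; apply: near0_imp H => t; rewrite normrN. Qed.

Lemma bigOB N f g : bigO N f -> bigO N g -> bigO N (fun t => f t - g t).
Proof. by move=> /bigOD fN /bigON gN; exact: fN. Qed.

Lemma bigOM N N' f g : bigO N f -> bigO N' g -> bigO (N + N') (fun t => f t * g t).
Proof.
move=> [C H] [D K]; exists (C * D); apply: near0_imp (near0I H K) => t [h k].
by rewrite normrM exprD mulrACA ler_pM.
Qed.

Lemma bigO_cst c : bigO 0 (fun=> c).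
Proof. by exists `|c|, 1 => // t _; rewrite expr0 mulr1. Qed.

Lemma bigO_id : bigO 1 id.
Proof. by exists 1, 1 => // t /andP[/ltW t0 _]; rewrite expr1 mul1r ger0_norm. Qed.

Lemma bigO_le N N' f : (N' <= N)%N -> bigO N f -> bigO N' f.
Proof.
move=> NN /bigO_ge0[C C0 H]; exists C.
apply: near0_imp (near0I (near0_lt ltr01) H) => t [/andP[t0 t1]] /le_trans; apply.
by rewrite ler_wpM2l // ler_wiXn2l // ltW.
Qed.

Lemma bigO_comp (T : R -> R) c P : 0 < c -> near0 (fun z => 0 < T z <= c * z) ->
  near0 P -> near0 (fun z => P (T z)).
Proof.
move=> c0 hT [d d0 Pd].
apply: near0_imp (near0I (near0_lt (divr_gt0 d0 c0)) hT) => z [/andP[z0 zd] /andP[T0 Tz]].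
apply: Pd; rewrite T0 /=; apply: le_lt_trans Tz _.
by move: zd; rewrite ltr_pdivlMr // mulrC.
Qed.

Lemma bigO_subst N f (T : R -> R) c : 0 < c -> near0 (fun z => 0 < T z <= c * z) ->
  bigO N f -> bigO N (fun z => f (T z)).
Proof.
move=> c0 hT /bigO_ge0[C C0 H]; exists (C * c ^+ N).
apply: near0_imp (near0I hT (bigO_comp c0 hT H)) => z [/andP[T0 Tz] h].
apply: le_trans h _; rewrite -mulrA -exprMn ler_wpM2l //.
by rewrite lerXn2r // nnegrE ltW // (lt_le_trans T0).
Qed.

Lemma bigO_horner N p f g : bigO 0 f -> bigO 0 g -> bigO N (fun t => f t - g t) ->
  bigO 0 (fun t => p.[f t]) /\ bigO N (fun t => p.[f t] - p.[g t]).
Proof.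
move=> f0 g0 fg; elim/poly_ind: p => [|p c [IH0 IHN]].
  split; first by apply: bigO_ext (bigO_cst 0) => t; rewrite horner0.
  by apply: bigO_ext (bigOB fg fg) => t; rewrite !horner0 !subrr.
split.
  apply: bigO_ext (bigOD (bigOM IH0 f0) (bigO_cst c)) => t.
  by rewrite hornerMXaddC.
have h1 := bigOM IH0 fg; have h2 := bigOM IHN g0; rewrite add0n in h1; rewrite addn0 in h2.
apply: bigO_ext (bigOD h1 h2) => t; rewrite !hornerMXaddC; ring.
Qed.

Lemma bigO_horner0 p : bigO 0 (fun t => p.[t]).
Proof.
have id0 : bigO 0 (@id R) := bigO_le (leq0n 1) bigO_id.
by have [] := @bigO_horner 0 p id id id0 id0 (bigOB id0 id0).
Qed.

Lemma bigO1_cst c : bigO 1 (fun=> c) -> c = 0.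
Proof.
move=> /bigO_ge0[C C0 [d d0 H]]; apply/eqP; rewrite -normr_le0 leNgt; apply/negP => c0.
have C1 : 0 < C + 1 by rewrite ltr_wpDl.
pose t := Num.min (d / 2) (`|c| / (C + 1) / 2).
have t0 : 0 < t by rewrite lt_min !divr_gt0.
have td : t < d by rewrite gt_min ltr_pdivrMr // mulr_natr mulr2n ltrDl d0.
have := H t; rewrite t0 td expr1 => /(_ erefl).
have : t <= `|c| / (C + 1) / 2 by rewrite ge_min lexx orbT.
rewrite ler_pdivlMr // ler_pdivlMr // => h1 h2.
nra.
Qed.

(** Uniqueness of asymptotic expansions, by which estimates for small arguments become identities of
    coefficients. *)
Lemma bigO_horner_coef N p : bigO N.+1 (fun t => p.[t]) -> forall k, (k <= N)%N -> p`_k = 0.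
Proof.
elim: N p => [|N IH] p; elim/poly_ind: p => [|p c _] H k; rewrite ?coef0 //.
  rewrite leqn0 => /eqP ->; rewrite coefD coefMX coefC /= add0r; apply: bigO1_cst.
  have pt := bigOM (bigO_horner0 p) bigO_id.
  by apply: bigO_ext (bigOB H pt) => t; rewrite hornerMXaddC addrAC subrr add0r.
have c0 : c = 0.
  apply: bigO1_cst; have pt := bigOM (bigO_horner0 p) bigO_id.
  apply: bigO_ext (bigOB (bigO_le _ H) pt) => // t.
  by rewrite hornerMXaddC addrAC subrr add0r.
case: k => [_|k kN]; first by rewrite coefD coefMX coefC /= add0r.
rewrite coefD coefMX coefC /= addr0; apply: IH => //.
have [C Hp] := H; exists C.
apply: near0_imp (near0I (near0_lt ltr01) Hp) => t [/andP[t0 _]].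
by rewrite hornerMXaddC c0 addr0 normrM (gtr0_norm t0) exprSr mulrA ler_pM2r.
Qed.

End Asymptotics.

(** * Power series inversion with nonnegative coefficients *)

Section Inversion.
Context {R : realType}.
Implicit Types (p q : {poly R}) (x y z : R).

Definition nneg_coefs p := forall k, 0 <= p`_k.

Lemma nneg_coefsM p q : nneg_coefs p -> nneg_coefs q -> nneg_coefs (p * q).
Proof. by move=> hp hq k; rewrite coefM sumr_ge0 // => i _; rewrite mulr_ge0. Qed.

Lemma nneg_coefsX n p : nneg_coefs p -> nneg_coefs (p ^+ n).
Proof.
move=> hp; elim: n => [|n IH]; last by rewrite exprS; exact: nneg_coefsM.
by move=> k; rewrite expr0 coef1 ler0n.
Qed.

Lemma nneg_coefs_comp p q : nneg_coefs p -> nneg_coefs q -> nneg_coefs (p \Po q).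
Proof.
move=> hp hq k; rewrite comp_polyE coef_sum sumr_ge0 // => i _.
by rewrite coefZ mulr_ge0 //; exact: nneg_coefsX.
Qed.

Lemma nneg_horner_ge0 p x : nneg_coefs p -> 0 <= x -> 0 <= p.[x].
Proof.
move=> pn x0; rewrite horner_coef; apply: sumr_ge0 => i _.
by rewrite mulr_ge0 ?exprn_ge0.
Qed.

Lemma nneg_horner_le p x y : nneg_coefs p -> 0 <= x <= y -> p.[x] <= p.[y].
Proof.
move=> pn /andP[x0 xy]; rewrite !horner_coef; apply: ler_sum => i _.
rewrite ler_wpM2l //.
by rewrite lerXn2r ?nnegrE ?(le_trans x0).
Qed.

Lemma nneg_coef_le p x k : nneg_coefs p -> 0 <= x -> p`_k * x ^+ k <= p.[x].
Proof.
move=> pn x0.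
have [kp|kp] := ltnP k (size p); last first.
  by rewrite nth_default // mul0r nneg_horner_ge0.
rewrite horner_coef (bigD1 (Ordinal kp)) //= lerDl; apply: sumr_ge0 => i _.
by rewrite mulr_ge0 ?exprn_ge0.
Qed.

Lemma nneg_poly (N : nat) (b : nat -> R) : (forall k, 0 <= b k) ->
  nneg_coefs (\poly_(k < N) b k).
Proof. by move=> b0 k; rewrite coef_poly; case: ifP. Qed.

(* Iterates towards the power series solution [w] of [w = z p(w)]. *)
Fixpoint fixpoint_poly p i : {poly R} :=
  if i is i'.+1 then 'X * (p \Po fixpoint_poly p i') else 0.

Lemma fixpoint_poly_horner p i z :
  (fixpoint_poly p i.+1).[z] = z * p.[(fixpoint_poly p i).[z]].
Proof. by rewrite /= hornerM hornerX horner_comp. Qed.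

Section FixpointBounds.
Variables (p : {poly R}) (z0 w0 : R).
Hypotheses (pn : nneg_coefs p) (p0 : p`_0 = 1) (z00 : 0 < z0) (w00 : 0 <= w0)
  (zw : z0 * p.[w0] <= w0).

Lemma fixpoint_poly_nneg i : nneg_coefs (fixpoint_poly p i).
Proof.
elim: i => [|i IH] k /=; first by rewrite coef0.
rewrite coefXM; case: ifP => // _; exact: nneg_coefs_comp.
Qed.

(** [zw] makes [0, w0] stable under w -> z p(w) for 0 <= z <= z0, a majorant bound uniform in
    [i]. *)
Lemma fixpoint_poly_le i z : 0 <= z <= z0 -> 0 <= (fixpoint_poly p i).[z] <= w0.
Proof.
move=> /andP[zp zz0].
have f0 j : 0 <= (fixpoint_poly p j).[z].
  by apply: nneg_horner_ge0 => //; exact: fixpoint_poly_nneg.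
rewrite f0 /=; elim: i => [|i IH]; first by rewrite horner0.
rewrite fixpoint_poly_horner (le_trans _ zw) // ler_pM //.
  exact: nneg_horner_ge0.
by rewrite nneg_horner_le // IH f0.
Qed.

Lemma fixpoint_poly_linear i : near0 (fun z => 0 < (fixpoint_poly p i.+1).[z] <= p.[w0] * z).
Proof.
exists z0 => // z /andP[zp /ltW zz0]; rewrite fixpoint_poly_horner.
have /andP[f0 fw] := @fixpoint_poly_le i z (introT andP (conj (ltW zp) zz0)).
have pf : 1 <= p.[(fixpoint_poly p i).[z]].
  by have := nneg_coef_le 0 pn f0; rewrite p0 expr0 mulr1.
apply/andP; split; first by rewrite mulr_gt0 // (lt_le_trans ltr01).
by rewrite mulrC ler_pM2r // nneg_horner_le // f0.
Qed.

(** Each iteration gains one order, because of the factor ['X]. *)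
Lemma fixpoint_poly_approx i :
  bigO i.+1 (fun z => (fixpoint_poly p i.+1).[z] - (fixpoint_poly p i).[z]).
Proof.
elim: i => [|i IH].
  have := bigOM (bigO_horner0 p.[0]%:P) (@bigO_id R).
  by apply: bigO_ext => z; rewrite fixpoint_poly_horner !horner0 hornerC subr0 mulrC.
have [_ h] := bigO_horner p (bigO_horner0 _) (bigO_horner0 _) IH.
apply: bigO_ext (bigOM (@bigO_id R) h) => z.
by rewrite !(fixpoint_poly_horner p) mulrBr.
Qed.

End FixpointBounds.

(* If [\sum_k M_k (t / h^n')^k = \sum_k m_k t^k] asymptotically, then substituting
   for [t] the solution of [t = z h(t)^n'] exhibits the [M_k] as coefficients of a
   series with nonnegative coefficients. *)
Lemma moment_bound (L : R) (n' : nat) (b m M : nat -> R) (h : R -> R) : 1 <= L ->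
  b 0%N = 1 -> (forall k, 0 <= b k <= L ^+ k) -> (forall k, 0 <= m k <= L ^+ k) ->
  (forall N, bigO N (fun t => h t - (\poly_(k < N) b k).[t])) ->
  (forall N, bigO N (fun t => (\poly_(k < N) M k).[t / h t ^+ n'] - (\poly_(k < N) m k).[t])) ->
  forall N, M N <= 2 * (4 * n'.+1%:R * L) ^+ N.
Proof.
move=> L1 b0 bL mL Hh HM N.
have L0 : 0 < L by lra.
set nn : R := n'.+1%:R.
have nnE : nn = n'%:R + 1 by rewrite /nn natr1.
have n1 : 1 <= nn by rewrite /nn ler1n.
have n0 : 0 < nn by lra.
have nn2 : 0 < 2 * nn by lra.
have q1 : 0 < 1 - (2 * nn)^-1 by rewrite subr_gt0 invf_lt1 //; lra.
clearbody nn.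
(* At [w0] the sums are dominated by a geometric series of ratio q = 1 / (2n), n = n' + 1. Bernoulli
   gives (1 - q)^n' >= 1/2, hence p(w0) <= 2, so z0 = w0 / 2 satisfies z0 p(w0) <= w0. This is the
   origin of the 4. *)
pose w0 := (2 * nn * L)^-1; pose z0 := (4 * nn * L)^-1.
have w00 : 0 < w0 by rewrite invr_gt0 !mulr_gt0.
have z00 : 0 < z0 by rewrite invr_gt0 !mulr_gt0.
have zw : z0 * 2 = w0 by rewrite /z0 /w0; field; rewrite ?lt0r_neq0.
have Lw : L * w0 = (2 * nn)^-1 by rewrite /w0; field; rewrite ?lt0r_neq0.
have geom K (c : nat -> R) : (forall k, 0 <= c k <= L ^+ k) ->
    (\poly_(k < K) c k).[w0] <= (1 - (2 * nn)^-1)^-1.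
  move=> cL; rewrite horner_poly -Lw.
  have Lw1 : L * w0 < 1 by rewrite Lw -subr_gt0.
  have q0 : 0 <= L * w0 by rewrite mulr_ge0 // ltW.
  rewrite -[leRHS]mul1r ler_pdivlMr ?subr_gt0 //.
  apply: (@le_trans _ _ ((\sum_(i < K) (L * w0) ^+ i) * (1 - L * w0))).
    rewrite ler_wpM2r ?subr_ge0 ?(ltW Lw1) //; apply: ler_sum => i _.
    by rewrite exprMn ler_wpM2r ?exprn_ge0 ?(ltW w00) //; case/andP: (cL i).
  rewrite mulrC -[leLHS]opprK -mulNr opprB -subrX1 opprB lerBlDr lerDl.
  exact: exprn_ge0.
pose H := \poly_(k < N.+1) b k; pose p := H ^+ n'.
have Hn : nneg_coefs H by apply: nneg_poly => k; case/andP: (bL k).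
have pn : nneg_coefs p by exact: nneg_coefsX.
have H0 : H`_0 = 1 by rewrite coef_poly.
have p0 : p`_0 = 1 by rewrite -horner_coef0 horner_exp horner_coef0 H0 expr1n.
have pw : z0 * p.[w0] <= w0.
  rewrite -[leRHS]zw ler_pM2l // horner_exp.
  apply: (@le_trans _ _ ((1 - (2 * nn)^-1)^-1 ^+ n')).
    have H0w : 0 <= H.[w0] := nneg_horner_ge0 Hn (ltW w00).
    apply: lerXn2r; rewrite ?nnegrE //; last exact: geom.
    by rewrite invr_ge0 ltW.
  rewrite exprVn -[leRHS]invrK lef_pV2 ?posrE ?invr_gt0 ?exprn_gt0 //.
  have bern k : 1 - k%:R * (2 * nn)^-1 <= (1 - (2 * nn)^-1) ^+ k :> R.
    elim: k => [|k IH]; first by rewrite mul0r subr0 expr0.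
    have qi : 0 < (2 * nn)^-1 :> R by rewrite invr_gt0 mulr_gt0.
    rewrite exprS -natr1; have := ler_wpM2l (ltW q1) IH; apply: le_trans.
    have : 0 <= k%:R * (2 * nn)^-1 ^+ 2 :> R by rewrite mulr_ge0 // exprn_ge0 // ltW.
    by set q := (_)^-1; set x := k%:R; nra.
  apply: le_trans (bern n').
  by rewrite lerBrDr -lerBrDl ler_pdivrMr // nnE; set x := n'%:R; lra.
(* Consecutive iterates agree up to order z^(N+1), so [W] solves W = z p(W) at least to the
   precision that coefficient [N] requires. *)
pose W := fixpoint_poly p N.+1; pose W' := fixpoint_poly p N.
have WO := fixpoint_poly_approx p N; rewrite -/W -/W' in WO.
have Wlin := fixpoint_poly_linear pn p0 z00 (ltW w00) pw N; rewrite -/W in Wlin.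
have pw0 : 0 < p.[w0].
  by have := nneg_coef_le 0 pn (ltW w00); rewrite p0 expr0 mulr1; apply: lt_le_trans.
have hO := bigO_subst pw0 Wlin (Hh N.+1); rewrite -/H in hO.
have h0 : bigO 0 (fun z => h W.[z]).
  by apply: bigO_ext (bigOD (bigO_le (leq0n _) hO) (bigO_horner0 (H \Po W))) => z;
    rewrite horner_comp subrK.
have HW0 : bigO 0 (fun z => H.[W.[z]]).
  by apply: bigO_ext (bigO_horner0 (H \Po W)) => z; rewrite horner_comp.
have [_ hp] := bigO_horner 'X^n' h0 HW0 hO.
have [_ pWW] := bigO_horner p (bigO_horner0 W) (bigO_horner0 W') WO.
have TO : bigO N.+1 (fun z => W.[z] - z * h W.[z] ^+ n').
  have e1 := bigO_le (leqnSn _) (bigOM (@bigO_id R) pWW).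
  have e2 := bigO_le (leqnSn _) (bigOM (@bigO_id R) hp).
  apply: bigO_ext (bigON (bigOD e1 e2)) => z.
  rewrite !hornerXn (fixpoint_poly_horner p N) -/W' /p !horner_exp; ring.
(* h(W(z)) stays away from 0, so dividing by its powers preserves orders. *)
have hpos : near0 (fun z => 2^-1 <= h W.[z]).
  have [C C0 HC] := bigO_ge0 hO.
  have C1 : 0 < (2 * (C + 1))^-1 by rewrite invr_gt0 mulr_gt0 // ltr_wpDl.
  apply: near0_imp (near0I (near0I (near0_lt C1) (near0_lt ltr01)) (near0I HC Wlin)).
  move=> z [[/andP[zp zC] /andP[_ z1]] [hz /andP[Wz _]]].
  have : 1 <= H.[W.[z]] by have := nneg_coef_le 0 Hn (ltW Wz); rewrite H0 expr0 mulr1.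
  have : C * z ^+ N.+1 <= 2^-1.
    apply: (@le_trans _ _ ((C + 1) * z)).
      rewrite ler_pM ?exprn_ge0 ?lerDl ?(ltW zp) //.
      by rewrite exprS ler_piMr ?(ltW zp) // exprn_ile1 // ltW.
    by move: zC; rewrite -div1r ltr_pdivlMr ?mulr_gt0 ?ltr_wpDl //; lra.
  move: hz; rewrite ler_norml => /andP[]; lra.
have hinv : bigO 0 (fun z => (h W.[z] ^+ n')^-1).
  exists (2 ^+ n'); apply: near0_imp hpos => z hz.
  have hp0 : 0 < h W.[z] by lra.
  rewrite expr0 mulr1 ger0_norm ?invr_ge0 ?exprn_ge0 ?(ltW hp0) // -exprVn.
  rewrite lerXn2r ?nnegrE ?invr_ge0 ?(ltW hp0) //.
  by rewrite -[leRHS]invrK lef_pV2 ?posrE ?invr_gt0.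
(* Substituting t = W(z) turns t / h(t)^n' into z up to order z^(N+1). *)
pose zz z := W.[z] / h W.[z] ^+ n'.
have zzO : bigO N.+1 (fun z => zz z - z).
  have := bigOM TO hinv; rewrite addn0; apply: bigO_near.
  apply: near0_imp hpos => z hz; rewrite mulrBl mulfK // expf_neq0 //.
  by apply: lt0r_neq0; lra.
have zz0 : bigO 0 zz.
  have := bigOM (bigO_horner0 W) hinv; exact.
have id0 : bigO 0 (@id R) := bigO_le (leq0n 1) (@bigO_id R).
have [_ Mz] := bigO_horner (\poly_(k < N.+1) M k) zz0 id0 zzO.
have HMz := bigO_subst pw0 Wlin (HM N.+1).
pose Pm := \poly_(k < N.+1) m k; pose PM := \poly_(k < N.+1) M k.
have D0 : bigO N.+1 (fun z => (PM - (Pm \Po W)).[z]).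
  apply: bigO_ext (bigOB HMz Mz) => z.
  by rewrite hornerD hornerN horner_comp -/PM -/Pm -/(zz z); ring.
have := bigO_horner_coef D0 (leqnn N).
rewrite coefB coef_poly ltnSn => /eqP; rewrite subr_eq0 => /eqP ->.
have Pmn : nneg_coefs Pm by apply: nneg_poly => k; case/andP: (mL k).
have Qn : nneg_coefs (Pm \Po W) by apply: nneg_coefs_comp => //; exact: fixpoint_poly_nneg.
have := nneg_coef_le N Qn (ltW z00).
rewrite horner_comp => /le_trans H1.
rewrite -ler_pdivrMr ?exprn_gt0 ?mulr_gt0 // -exprVn -/z0; apply: H1.
have /andP[Wz Ww] : 0 <= W.[z0] <= w0.
  by apply: (fixpoint_poly_le pn (ltW w00) pw); rewrite (ltW z00) lexx.
apply: (@le_trans _ _ Pm.[w0]); first by rewrite nneg_horner_le // Wz.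
apply: le_trans (geom _ _ mL) _.
rewrite -[leRHS]invrK lef_pV2 ?posrE ?invr_gt0 //.
rewrite lerBrDr -lerBrDl -[_^-1]mul1r ler_pdivrMr //; lra.
Qed.

End Inversion.

(** * Boolean cumulants *)

Section BooleanCumulants.
Context {R : realType} {A : cstarAlgType R} (E : {scalar A}) (HE : prob_space E).
Implicit Types (a b x y : A) (t z : R).
Local Notation tau := (real_trace E).

Lemma resolvent_moments y z G N : inverses G (1 - z%:C *: y) ->
  tau G = \sum_(k < N) tau (y ^+ k) * z ^+ k + z ^+ N * tau (y ^+ N * G).
Proof.
move=> [_ Gr]; set u := z%:C *: y in Gr.
have GE : G = (\sum_(k < N) u ^+ k) + u ^+ N * G.
  by rewrite -[X in X + _]mulr1 -Gr mulrA geom_sumMr mulrBl mul1r subrK.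
have uE k : u ^+ k = (z ^+ k)%:C *: y ^+ k by rewrite exprZn -rmorphXn.
rewrite {1}GE tauD tau_sum; congr (_ + _).
  by apply: eq_bigr => k _; rewrite uE tauZ mulrC.
by rewrite uE -scalerAl tauZ.
Qed.

Lemma resolvent_cnorm y z G : inverses G (1 - z%:C *: y) ->
  cnorm (z%:C *: y) <= 2^-1 -> cnorm G <= 2.
Proof.
move=> [_ Gr] small; set u := z%:C *: y in Gr small.
have GE : G = 1 + u * G by rewrite -Gr mulrBl mul1r subrK.
have := cnormD 1 (u * G); rewrite -GE cnorm1 => h.
have := le_trans h (lerD (lexx 1) (cnormM u G)).
have := ler_wpM2r (cnorm_ge0 G) small; lra.
Qed.

Lemma resolvent_limit y z G : cnorm (z%:C *: y) < 1 -> inverses G (1 - z%:C *: y) ->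
  climit (fun n => \sum_(k < n) (z ^+ k)%:C *: y ^+ k) G.
Proof.
move=> small GI; have [G' [lim G1 G2]] := neumann_exists small.
rewrite (inverses_uniq GI (conj G1 G2)) => e /lim [N hN]; exists N => n /hN.
suff -> : \sum_(i < n) (z%:C *: y) ^+ i = \sum_(k < n) (z ^+ k)%:C *: y ^+ k by [].
by apply: eq_bigr => i _; rewrite exprZn -rmorphXn.
Qed.

Lemma resolvent_exists y z : cnorm (z%:C *: y) < 1 ->
  exists G, inverses G (1 - z%:C *: y).
Proof. by move=> /neumann_exists[G [_ G1 G2]]; exists G. Qed.

Lemma resolvent_self_adjoint y z G : self_adjoint y -> inverses G (1 - z%:C *: y) ->
  self_adjoint G.
Proof.
move=> sy GI; apply: inverses_uniq (GI); case: GI => [Gl Gr].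
have su : adj (1 - z%:C *: y) = 1 - z%:C *: y by rewrite cadjB cadj1 cadjZr sy.
by split; rewrite -su -adjM ?Gl ?Gr cadj1.
Qed.

Lemma resolvent_equidistributed x y z G G' : (forall k, E (x ^+ k) = E (y ^+ k)) ->
  cnorm (z%:C *: x) < 1 -> cnorm (z%:C *: y) < 1 ->
  inverses G (1 - z%:C *: x) -> inverses G' (1 - z%:C *: y) -> E G = E G'.
Proof.
move=> xy sx sy /(resolvent_limit sx) lx /(resolvent_limit sy) ly.
apply/eqP; rewrite -subr_eq0 -EB.
have lim := climitD lx (climitZ (-1) ly); rewrite scaleN1r in lim.
rewrite (E_limit HE lim (z := 0)) // => n /=.
rewrite ED EZ mulN1r !E_sum (eq_bigr (fun k : 'I_n => E ((z ^+ k)%:C *: y ^+ k))) ?subrr // => k _.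
by rewrite !EZ xy.
Qed.

Lemma scaled_small y : exists2 c, 0 < c & forall z, 0 <= z <= c -> cnorm (z%:C *: y) <= 2^-1.
Proof.
exists (2 * (cnorm y + 1))^-1; first by rewrite invr_gt0 mulr_gt0 // ltr_wpDl ?cnorm_ge0.
move=> z /andP[z0 zc]; rewrite cnormZr ger0_norm //.
have y0 := cnorm_ge0 y; have := ler_wpM2r (addr_ge0 y0 ler01) zc.
have -> : (2 * (cnorm y + 1))^-1 * (cnorm y + 1) = 2^-1 by field; lra.
have : z * cnorm y <= z * (cnorm y + 1) by rewrite ler_wpM2l // lerDl.
exact: le_trans.
Qed.

Section Element.
Variables (x : A) (xpos : cpositive x) (Ex : tau x = 1).
Local Notation L := (cnorm x).

(* [x] followed by the compression to the complement of the vacuum vector. *)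
Fixpoint boolean_vector k : A :=
  if k is k'.+1 then x * boolean_vector k' - (tau (x * boolean_vector k'))%:C *: 1 else 1.

(** Index [k] carries the Boolean cumulant of order k + 1, so that index 0 is the mean. *)
Definition boolean_cumulant k := tau (x * boolean_vector k).

Lemma boolean_vector_comm k : GRing.comm x (boolean_vector k).
Proof.
elim: k => [|k IH] /=; first exact: commr1.
by apply: commrB; [apply: commrM => //; exact: commr_refl|apply: commZ; exact: commr1].
Qed.

Lemma boolean_vector_self_adjoint k : self_adjoint (boolean_vector k).
Proof.
elim: k => [|k IH] /=; first exact: csa1.
apply: csaB; last by apply: csaZ; exact: csa1.
by apply: csaM => //; [exact: boolean_vector_comm|exact: cpositive_self_adjoint].
Qed.

Lemma boolean_vector_mean k : tau (boolean_vector k.+1) = 0.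
Proof. by rewrite /= tauB tauZ tau1 // mulr1 subrr. Qed.

(** The compression of [x] is symmetric for the trace form: moving one step across subtracts the
    same product of two cumulants on either side. Cumulants of both parities thereby become
    quadratic forms. *)
Lemma boolean_cumulant_split i j :
  boolean_cumulant (i + j) = tau (boolean_vector i * (x * boolean_vector j)).
Proof.
elim: i j => [|i IH] j; first by rewrite /= mul1r.
rewrite addSnnS IH /= -[tau (x * boolean_vector i)]/(boolean_cumulant i).
rewrite -[tau (x * boolean_vector j)]/(boolean_cumulant j).
rewrite !mulrBr mulrBl !tauB -!scalerAr !mulr1 -!scalerAl mul1r !tauZ.
rewrite -(boolean_vector_comm i) -!mulrA -[tau (x * boolean_vector i)]/(boolean_cumulant i).
rewrite -[tau (x * boolean_vector j)]/(boolean_cumulant j).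
rewrite (mulrA (boolean_vector i)) -(boolean_vector_comm i) -!mulrA; ring.
Qed.

Lemma boolean_cumulant_odd i :
  boolean_cumulant (i + i).+1 = tau (boolean_vector i.+1 ^+ 2).
Proof.
have vE : boolean_vector i.+1 = x * boolean_vector i - (boolean_cumulant i)%:C *: 1.
  by [].
rewrite -addSn boolean_cumulant_split expr2 {3}vE mulrBr tauB -scalerAr mulr1 tauZ.
by rewrite boolean_vector_mean mulr0 subr0.
Qed.

Lemma boolean_cumulant_even i :
  boolean_cumulant (i + i) = tau (boolean_vector i * (x * boolean_vector i)).
Proof. exact: boolean_cumulant_split. Qed.

Lemma boolean_cumulant0 : boolean_cumulant 0 = 1.
Proof. by rewrite /boolean_cumulant mulr1. Qed.

Lemma double_cases (P : nat -> Prop) :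
  (forall i, P (i + i)%N) -> (forall i, P (i + i).+1) -> forall k, P k.
Proof.
move=> Pe Po k; have := odd_double_half k; rewrite -addnn; case: (odd k) => <-.
  exact: Po.
exact: Pe.
Qed.

Lemma boolean_cumulant_ge0 k : 0 <= boolean_cumulant k.
Proof.
have [p [sp px _]] := cpositive_square HE xpos.
elim/double_cases: k => i.
  rewrite boolean_cumulant_even -px expr2 -!mulrA mulrA.
  have := tau_square_ge0 HE (p * boolean_vector i).
  by rewrite adjM sp boolean_vector_self_adjoint.
rewrite boolean_cumulant_odd; apply: tau_sq_ge0 => //.
exact: boolean_vector_self_adjoint.
Qed.

Lemma cnorm_ge1 : 1 <= L.
Proof. by rewrite -Ex; exact: tau_le. Qed.

(** Write v_i for [boolean_vector i]. From even to odd, v_(i+1) is x v_i less its mean, and the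
    trace of (x v_i)^2 is at most L times that of v_i x v_i. From odd to even, the trace of v x v is
    at most L times that of v^2. *)
Lemma boolean_cumulantS k : boolean_cumulant k.+1 <= L * boolean_cumulant k.
Proof.
have [p [sp px _]] := cpositive_square HE xpos.
have pL : cnorm p ^+ 2 = L by rewrite -cnorm_sq // px.
have conjE v : self_adjoint v -> tau (v * (x * v)) = tau (adj (p * v) * (p * v)).
  by move=> sv; rewrite csquare_adj sp sv -expr2 px mulrA.
elim/double_cases: k => i; have sv := boolean_vector_self_adjoint i.
  rewrite boolean_cumulant_odd boolean_cumulant_even conjE //.
  have := tau_square_conj_le HE p (p * boolean_vector i); rewrite pL.
  apply: le_trans; rewrite (mulrA p p) -(expr2 p) px adjM sv (cpositive_self_adjoint xpos).
  rewrite -(boolean_vector_comm i) -expr2 [boolean_vector i.+1]/=.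
  set w := x * _; rewrite [leLHS](_ : _ = tau (w ^+ 2) - tau w ^+ 2).
    by rewrite gerBl sqr_ge0.
  rewrite expr2 mulrBr -scalerAr mulr1 mulrBl -scalerAl mul1r !tauB !tauZ tauB tauZ tau1 //.
  by rewrite -expr2; ring.
have sv1 := boolean_vector_self_adjoint i.+1.
have -> : boolean_cumulant (i + i).+2 = boolean_cumulant (i.+1 + i.+1)
  by rewrite addSn addnS.
rewrite boolean_cumulant_odd boolean_cumulant_even conjE //.
have := tau_square_conj_le HE p (boolean_vector i.+1).
by rewrite pL sv1 -expr2.
Qed.

Lemma boolean_cumulant_le k : 0 <= boolean_cumulant k <= L ^+ k.
Proof.
rewrite boolean_cumulant_ge0 /=; elim: k => [|k IH].
  by rewrite expr0 boolean_cumulant0.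
rewrite exprS (le_trans (boolean_cumulantS k)) // ler_wpM2l ?cnorm_ge0 //.
Qed.

Lemma moment_le k : 0 <= tau (x ^+ k) <= L ^+ k.
Proof.
have [p [sp px _]] := cpositive_square HE xpos.
rewrite (le_trans (tau_le HE _) (cnormX _ _)) andbT -px -exprM mulnC exprM.
by apply: tau_sq_ge0 => //; exact: csaX.
Qed.

(** The sum [V] of t^k [boolean_vector k] over k <= N has mean 1, and (1 - t x) V telescopes to a
    scalar up to order t^(N+1); multiplying by [G] and taking traces gives the relation. *)
Lemma resolvent_boolean t G N : inverses G (1 - t%:C *: x) ->
  1 = (1 - t * (\poly_(k < N) boolean_cumulant k).[t]) * tau G
      - t ^+ N.+1 * tau (G * (x * boolean_vector N)).
Proof.
move=> [Gl Gr].
pose V := \sum_(k < N.+1) (t ^+ k)%:C *: boolean_vector k.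
have VE : (1 - t%:C *: x) * V = (1 - t * (\poly_(k < N) boolean_cumulant k).[t])%:C *: 1
    - (t ^+ N.+1)%:C *: (x * boolean_vector N).
  rewrite /V; elim: (N) => [|n IH].
    rewrite big_ord1 expr0 scalerC1 mulr1 horner_poly big_ord0 mulr0 subr0 scalerC1.
    by rewrite expr1 mulr1.
  rewrite big_ord_recr /= mulrDr IH !horner_poly big_ord_recr /=.
  rewrite -scalerAr mulrBl mul1r -scalerAl scalerBr scaler_real.
  rewrite -[_ - _ *: 1]/(boolean_vector n.+1) -exprSr.
  set w := (t ^+ n.+2)%:C *: _; rewrite addrA; congr (_ - _).
  rewrite [boolean_vector n.+1]/= scalerBr addrA subrK scaler_real.
  rewrite -[tau _]/(boolean_cumulant n) -scalerBl -rmorphB; congr (_%:C *: _).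
  rewrite exprS; ring.
have tauV : tau V = 1.
  rewrite /V tau_sum big_ord_recl /= expr0 scalerC1 tau1 // big1 ?addr0 // => i _.
  by rewrite tauZ [boolean_vector _]/= boolean_vector_mean mulr0.
rewrite -[LHS]tauV -[V]mul1r -Gl -mulrA VE mulrBr -!scalerAr mulr1 tauB !tauZ.
by [].
Qed.

End Element.

End BooleanCumulants.

(** * The factor h and its asymptotic expansion *)

Section SubordinationFactor.
Context {R : realType} {A : cstarAlgType R} (E : {scalar A}) (HE : prob_space E).
Implicit Types (a b y : A) (t z : R).
Local Notation tau := (real_trace E).
Variables (x : A) (xpos : cpositive x) (Ex : tau x = 1).
Local Notation L := (cnorm x).

(** The number e with E (1 - t x)^-1 = 1 / e. The default 0 is not reached for 0 < t <= (4 * L)^-1,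
    where the resolvent exists. *)
Definition reduced_trace t : R := (tau (xget 0 [set v | inverses v (1 - t%:C *: x)]%classic))^-1.

(* [(1 - reduced_trace t) / t = \sum_k b_(k+1) t^k] for the Boolean cumulants [b] of [x]. *)
Definition eta_factor t := (1 - reduced_trace t) / t.

Lemma reduced_trace_resolvent t G : 0 < t <= (4 * L)^-1 -> inverses G (1 - t%:C *: x) ->
  [/\ cnorm G <= 2, E G = (reduced_trace t)^-1%:C, 0 < reduced_trace t & reduced_trace t <= 2].
Proof.
move=> /andP[t0 tL] GI; have L1 := cnorm_ge1 HE Ex.
have small : cnorm (t%:C *: x) <= 4^-1.
  rewrite cnormZr gtr0_norm //; have := ler_wpM2r (cnorm_ge0 x) tL.
  by rewrite [leRHS](_ : _ = 4^-1) //; field; lra.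
have G2 : cnorm G <= 2 by apply: (resolvent_cnorm GI); lra.
have rE : reduced_trace t = (tau G)^-1.
  rewrite /reduced_trace; congr (tau _)^-1; case: xgetP => [v _ vI|/(_ G)//].
  exact: inverses_uniq vI GI.
have sG : self_adjoint G.
  by apply: resolvent_self_adjoint GI; exact: cpositive_self_adjoint.
(* [tau G] is 1 plus the trace of t x G, whose modulus is at most 1/4 times 2. *)
have tG : 2^-1 <= tau G.
  rewrite (resolvent_moments E 1 GI) big_ord1 !expr0 tau1 // mulr1 !expr1.
  rewrite -tauZ scalerAl; have := normtau_le HE (t%:C *: x * G).
  have := cnormM (t%:C *: x) G; have := cnorm_ge0 G; have := cnorm_ge0 (t%:C *: x).
  rewrite ler_norml; set u := cnorm (_ * _); set v := cnorm (_ *: _).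
  set g := cnorm G; set s := tau _ => v0 g0 uvg /andP[su _].
  have : v * g <= 4^-1 * 2 by rewrite ler_pM.
  lra.
split=> //; rewrite rE.
- by rewrite invrK; exact: E_self_adjoint.
- by rewrite invr_gt0; lra.
- by rewrite -[leRHS]invrK lef_pV2 ?posrE ?invr_gt0 //; lra.
Qed.

Lemma near0_reduced_trace : near0 (fun t => 0 < t <= (4 * L)^-1).
Proof.
have L1 := cnorm_ge1 HE Ex.
have c0 : 0 < (4 * L)^-1 by rewrite invr_gt0; lra.
by apply: near0_imp (near0_lt c0) => t /andP[-> /ltW ->].
Qed.

Lemma near0_resolvent y : near0 (fun t => cnorm (t%:C *: y) <= 2^-1).
Proof.
have [c c0 H] := scaled_small y.
by apply: near0_imp (near0_lt c0) => t /andP[/ltW t0 /ltW tc]; apply: H; rewrite t0.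
Qed.

Lemma eta_factor_poly N :
  bigO N (fun t => eta_factor t - (\poly_(k < N) boolean_cumulant E x k).[t]).
Proof.
exists (4 * cnorm (x * boolean_vector E x N)).
apply: near0_imp (near0I near0_reduced_trace (near0_resolvent x)) => t [tL small].
have [|G GI] := @resolvent_exists _ _ x t; first by lra.
have [G2 EG r0 r2] := reduced_trace_resolvent tL GI.
have tG : tau G = (reduced_trace t)^-1 by rewrite /real_trace EG.
have t0 : 0 < t by case/andP: tL.
have := resolvent_boolean HE N GI; rewrite tG.
set r := reduced_trace t in r0 r2 tG *; set H := horner _ _; set T := tau _ => eq.
(* The resolvent identity solved for 1 - e and divided by t; [r <= 2] and [cnorm G <= 2] account for
   the constant 4. *)
have {}eq : eta_factor t - H = r * T * t ^+ N.
  rewrite /eta_factor -/r.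
  have -> : 1 - r = t * H + r * T * t ^+ N.+1.
    have rr : r = 1 - t * H - r * (t ^+ N.+1 * T).
      transitivity (r * ((1 - t * H) * r^-1 - t ^+ N.+1 * T)); first by rewrite -eq mulr1.
      by field; exact: lt0r_neq0.
    by rewrite {1}rr; ring.
  by rewrite exprS; field; exact: lt0r_neq0.
rewrite eq normrM normrX (gtr0_norm t0) ler_wpM2r ?exprn_ge0 ?(ltW t0) //.
rewrite normrM (gtr0_norm r0).
have := normtau_le HE (G * (x * boolean_vector E x N)); rewrite -/T => hT.
have := le_trans hT (cnormM _ _); set w := cnorm (x * _) => h.
have w0 : 0 <= w by exact: cnorm_ge0.
have := ler_wpM2r w0 G2; have : r * `|T| <= 2 * `|T| by rewrite ler_wpM2r.
lra.
Qed.

(** The expansion begins with the mean 1 of [x]. *)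
Lemma near0_eta_factor : near0 (fun t => 2^-1 <= eta_factor t <= 2).
Proof.
have [C C0 HC] := bigO_ge0 (eta_factor_poly 1).
have C1 : 0 < (2 * (C + 1))^-1 by rewrite invr_gt0 mulr_gt0 // ltr_wpDl.
apply: near0_imp (near0I (near0_lt C1) HC) => t [/andP[t0 tC]].
rewrite horner_poly big_ord1 expr0 mulr1 boolean_cumulant0 // expr1 => h.
move: tC; rewrite -div1r ltr_pdivlMr ?mulr_gt0 ?ltr_wpDl // => tC.
move: h; rewrite ler_norml => /andP[]; nra.
Qed.

End SubordinationFactor.

(** * Products of free positive variables *)

Section ProductOfFree.
Context {R : realType} {A : cstarAlgType R} (E : {scalar A}) (HE : prob_space E).
Implicit Types (a b y : A) (t z : R).
Local Notation tau := (real_trace E).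
Context (I : eqType) (X : I -> A) (i0 : I) (Xfree : free_variables E X).
Hypotheses (Xpos : forall i, cpositive (X i)) (EX : forall i, E (X i) = 1)
  (Xid : forall i j k, E (X i ^+ k) = E (X j ^+ k)).
Local Notation e := (reduced_trace E (X i0)).
Local Notation eta := (eta_factor E (X i0)).

Lemma tauX i : tau (X i) = 1.
Proof. by rewrite /real_trace EX. Qed.

Lemma freely_alternating_mean (F : bool -> A -> Prop) a b :
  (forall i, unital_subspace (F i)) -> freely_alternating E F -> F true a -> F false b ->
  E (a * b) = E a * E b.
Proof.
move=> Fs Ffree Fa Fb.
have cent i y : F i y -> F i (y - E y *: 1) /\ E (y - E y *: 1) = 0.
  have [F1 Fl] := Fs i => Fy; rewrite EB EZ (E1 HE) mulr1 subrr; split=> //.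
  by rewrite addrC -scaleNr; apply: Fl.
have [Fa' a0] := cent _ _ Fa; have [Fb' b0] := cent _ _ Fb.
have := Ffree [:: (true, a - E a *: 1); (false, b - E b *: 1)].
rewrite wprod_cons wprod_letter /= => /(_ _ erefl) H.
have {}H : E ((a - E a *: 1) * (b - E b *: 1)) = 0 by apply: H.
move: H; rewrite mulrBr mulrBl -!scalerAr -!scalerAl mulr1 mul1r EB EB EZ EZ a0.
by rewrite mulr0 subr0 => /eqP; rewrite subr_eq0 => /eqP.
Qed.

Definition circX l := circ_prod [seq X i | i <- l].

Lemma circX_cons i l : l != [::] -> circX (i :: l) = circ (X i) (circX l).
Proof. by case: l. Qed.

Lemma circX_positive l : l != [::] -> cpositive (circX l).
Proof.
elim: l => [//|i l IH] _; have [->|l0] := eqVneq l [::]; first exact: Xpos.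
by rewrite circX_cons //; apply: (circ_positive HE) => //; exact: IH.
Qed.

Lemma csqrtX_mem i : closed_algebra_of X i (csqrt (X i)).
Proof.
have [q [_ _ _ _ csqrt_mem]] := csqrtP HE (Xpos i).
apply: (csqrt_mem (closed_algebra_of X i)); first exact: closed_algebra_ofP.
exact: closed_algebra_of_mem.
Qed.

Lemma circX_multiplier (J : pred I) l : l != [::] -> {subset l <= J} ->
  multiplier E X J (circX l).
Proof.
elim: l => [//|i l IH] _ lJ.
have Ji : J i by apply: lJ; rewrite mem_head.
have [->|l0] := eqVneq l [::].
  exact: (multiplier_letter HE Ji (closed_algebra_of_mem X i)).
rewrite circX_cons //; have Js := multiplier_letter HE Ji (csqrtX_mem i).
apply: multiplierM => //; apply: multiplierM => //; apply: IH => // j jl.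
by apply: lJ; rewrite inE jl orbT.
Qed.

Lemma circX_pow_mem (J : pred I) l k : l != [::] -> {subset l <= J} ->
  complementary_algebra E X J (circX l ^+ k).
Proof.
by move=> l0 lJ; apply: subset_norm_closure; apply: multiplier_pow; exact: circX_multiplier.
Qed.

Definition free_pair_family i (J : pred I) (b : bool) :=
  if b then closed_algebra_of X i else complementary_algebra E X J.

Lemma free_pair_subspace i J (c : bool) : unital_subspace (free_pair_family i J c).
Proof.
case: c => /=; first by have [B1 Bl _ _] := closed_algebra_ofP X i.
by apply: unital_subspace_closure; exact: free_product_lin.
Qed.

(** Variances add: with x = X - 1 and z = Z - 1 centered, freeness reduces E (X Z X Z) to E (X^2) +
    E (z^2). *)
Lemma circX_moments2 l : l != [::] -> uniq l ->
  E (circX l) = 1 /\ E (circX l ^+ 2) = 1 + (size l)%:R * (E (X i0 ^+ 2) - 1).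
Proof.
elim: l => [//|i l IH] _ /= /andP[il ul].
have [->|l0] := eqVneq l [::]; first by rewrite /circX /= EX (Xid i i0) mul1r addrC subrK.
rewrite circX_cons //; have {IH}[IH1 IH2] := IH l0 ul.
set Z := circX l in IH1 IH2 *; set s := csqrt (X i).
have ss : s * s = X i by rewrite -expr2; exact: (csqrt_sqr HE).
pose F := free_pair_family i (mem l).
have Ffree : freely_alternating E F by apply: (free_pair HE Xfree); rewrite inE.
have Fs c : unital_subspace (F c) by exact: free_pair_subspace.
have mean a b : F true a -> F false b -> E (a * b) = E a * E b.
  exact: freely_alternating_mean.
have FX k : F true (X i ^+ k).
  exact: (closed_subalgebraX k (closed_algebra_ofP X i) (closed_algebra_of_mem X i)).
have FZ k : F false (Z ^+ k) by apply: (@circX_pow_mem (mem l) l k).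
have circE : E (circ (X i) Z) = E (X i * Z).
  by rewrite /circ -/s E_trace // mulrA ss.
split; first by rewrite circE mean ?EX ?IH1 ?mulr1 //; [exact: (FX 1%N)|exact: (FZ 1%N)].
have -> : E (circ (X i) Z ^+ 2) = E (X i * Z * X i * Z).
  rewrite expr2 /circ -/s -!mulrA [LHS]E_trace // [RHS]E_trace // -!mulrA ss.
  by rewrite (mulrA s s) ss.
pose x := X i - 1; pose z := Z - 1.
have [F1 Fl] := Fs true; have [F1' Fl'] := Fs false.
have Fx : F true x by rewrite /x addrC -scaleN1r; apply: Fl => //; exact: (FX 1%N).
have Fz : F false z by rewrite /z addrC -scaleN1r; apply: Fl' => //; exact: (FZ 1%N).
have x0 : E x = 0 by rewrite EB EX E1 // subrr.
have z0 : E z = 0 by rewrite EB IH1 E1 // subrr.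
have Fzz : F false (z ^+ 2).
  have -> : z ^+ 2 = (-1) *: z + ((-1) *: Z + Z ^+ 2).
    have Zz : Z * z = Z ^+ 2 - Z by rewrite /z mulrBr mulr1 -expr2.
    by rewrite !scaleN1r {1}expr2 {1}/z mulrBl mul1r Zz [LHS]addrC [X in _ = _ + X]addrC.
  by apply: (Fl') => //; apply: (Fl'); [exact: (FZ 1%N)|exact: (FZ 2%N)].
have xzxz : E (x * z * x * z) = 0.
  have := Ffree [:: (true, x); (false, z); (true, x); (false, z)].
  by rewrite !wprod_cons wprod_nil mulr1 !mulrA /=; apply.
have Xx : X i = 1 + x by rewrite addrC subrK.
have Zz : Z = 1 + z by rewrite addrC subrK.
have e1 : E (X i * Z * X i * Z) = E (X i ^+ 2 * Z) + E (X i * z * X i * Z).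
  by rewrite {1}Zz mulrDr mulr1 !mulrDl ED -expr2.
have e2 : E (X i * z * X i * Z) = E (X i ^+ 2 * z) + E (X i * z * X i * z).
  by rewrite {1}Zz mulrDr mulr1 ED; congr (_ + _); rewrite E_trace // mulrA -expr2.
have e3 : E (X i * z * X i * z) = E (X i * z ^+ 2) + E (x * z * X i * z).
  rewrite {1}Xx !mulrDl mul1r ED; congr (_ + _).
  by rewrite E_trace // mulrA -expr2 E_trace.
have e4 : E (x * z * X i * z) = E (x * z ^+ 2) + E (x * z * x * z).
  by rewrite Xx (mulrDr (x * z)) mulr1 mulrDl ED -(mulrA x) -expr2.
have FX1 := FX 1%N; have FX2 := FX 2%N; have FZ1 := FZ 1%N.
rewrite e1 e2 e3 e4 xzxz (mean (X i ^+ 2) Z) // (mean (X i ^+ 2) z) //.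
rewrite (mean (X i) (z ^+ 2)) // (mean x (z ^+ 2)) //.
rewrite x0 z0 IH1 EX (Xid i i0 2) mul0r mulr0 !addr0 add0r mulr1 mul1r.
have -> : E (z ^+ 2) = E (Z ^+ 2) - 1.
  rewrite /z expr2 mulrBr mulr1 mulrBl mul1r !EB IH1 E1 // subrr subr0 -expr2 //.
by rewrite IH2 -natr1; ring.
Qed.

Definition subordination m t := t / eta t ^+ m.

Lemma near0_subordination m :
  near0 (fun t => 0 < subordination m t /\ subordination m t <= 2 ^+ m * t).
Proof.
apply: near0_imp (near0I (near0_lt ltr01) (near0_eta_factor HE (Xpos i0) (tauX i0))).
move=> t [/andP[t0 _] /andP[h1 h2]]; have h0 : 0 < eta t by lra.
split; first by rewrite divr_gt0 // exprn_gt0.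
rewrite /subordination mulrC ler_pM2r // -exprVn lerXn2r ?nnegrE ?invr_ge0 ?(ltW h0) //.
by rewrite -[leRHS]invrK lef_pV2 ?posrE ?invr_gt0.
Qed.

Lemma near0_subordination_small m y :
  near0 (fun t => cnorm ((subordination m t)%:C *: y) <= 2^-1).
Proof.
have c0 : 0 < 2 ^+ m :> R by rewrite exprn_gt0.
have sub : near0 (fun t => 0 < subordination m t <= 2 ^+ m * t).
  by apply: near0_imp (near0_subordination m) => t [-> ->].
exact: bigO_comp c0 sub (near0_resolvent y).
Qed.

(** With r = e(t) and z of order t both terms are O(t). So al and be are O(t), and be al / (1 - e)
    is O(t) too since 1 - e = t h(t), which makes its Neumann series converge. *)
Lemma cnorm_one_sub_resolvent y z (r : R) G : 0 < z -> 0 < r <= 2 ->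
  inverses G (1 - z%:C *: y) -> cnorm G <= 2 ->
  cnorm (1 - r%:C *: G) <= `|1 - r| + 4 * (z * cnorm y).
Proof.
move=> z0 /andP[r0 r2] [_ Gr] G2; set u := z%:C *: y in Gr.
have GE : 1 - r%:C *: G = (1 - r)%:C *: 1 - r%:C *: (u * G).
  have GE : G = 1 + u * G by rewrite -Gr mulrBl mul1r subrK.
  by rewrite {1}GE scalerDr opprD addrA rmorphB scalerBl scalerC1.
rewrite GE (le_trans (cnormB _ _)) // cnormZr cnorm1 mulr1 lerD2l.
rewrite cnormZr gtr0_norm // -[4%:R](_ : 2 * (1 * 2) = _ :> R); last by lra.
rewrite -mulrA ler_pM ?cnorm_ge0 ?(ltW r0) //.
rewrite (le_trans (cnormM _ _)) // /u cnormZr gtr0_norm // mul1r [leRHS]mulrC.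
by rewrite ler_wpM2l // mulr_ge0 ?cnorm_ge0 // ltW.
Qed.

Lemma resolvent_mem (B : A -> Prop) y z G : unital_subspace B ->
  (forall u a, (forall n, B (u n)) -> climit u a -> B a) -> (forall k, B (y ^+ k)) ->
  cnorm (z%:C *: y) <= 2^-1 -> inverses G (1 - z%:C *: y) -> B G.
Proof.
move=> [B1 Bl] Blim By small GI.
have B0 : B 0 by have := Bl (-1) _ _ B1 B1; rewrite scaleN1r addrC subrr.
apply: Blim (resolvent_limit _ GI); last by lra.
elim=> [|n IH]; first by rewrite big_ord0.
by rewrite big_ord_recr /= addrC; apply: Bl.
Qed.

Lemma near0_X_resolvent i : near0 (fun t => exists G, [/\ inverses G (1 - t%:C *: X i),
  E G = (e t)^-1%:C, cnorm G <= 2 & closed_algebra_of X i G]).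
Proof.
apply: near0_imp (near0I (near0_reduced_trace HE (tauX i0))
  (near0I (near0_resolvent (X i0)) (near0_resolvent (X i)))) => t [tL [s0 s1]].
have [|G0 G0I] := @resolvent_exists _ _ (X i0) t; first by lra.
have [|G GI] := @resolvent_exists _ _ (X i) t; first by lra.
have [_ EG0 _ _] := reduced_trace_resolvent HE (Xpos i0) (tauX i0) tL G0I.
exists G; split=> //.
- rewrite -EG0; apply: (resolvent_equidistributed HE _ _ _ GI G0I); [|lra|lra].
  by move=> k; exact: Xid.
- exact: resolvent_cnorm GI s1.
have HB := closed_algebra_ofP X i; have [B1 Bl _ Blim] := HB.
apply: (resolvent_mem _ Blim _ s1 GI) => // k.
exact: closed_subalgebraX HB (closed_algebra_of_mem X i).
Qed.

Lemma near0_reduced_trace_eta : near0 (fun t =>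
  [/\ 0 < t, 0 < e t <= 2, 1 - e t = t * eta t & 2^-1 <= eta t <= 2]).
Proof.
apply: near0_imp (near0I (near0I (near0_reduced_trace HE (tauX i0)) (near0_resolvent (X i0)))
  (near0_eta_factor HE (Xpos i0) (tauX i0))) => t [[tL s0] h].
have [|G GI] := @resolvent_exists _ _ (X i0) t; first by lra.
have [_ _ r0 r2] := reduced_trace_resolvent HE (Xpos i0) (tauX i0) tL GI.
have t0 : 0 < t by case/andP: tL.
split=> //; first by rewrite r0.
by rewrite /eta_factor mulrC divfK // lt0r_neq0.
Qed.

Lemma circX_resolvent l : l != [::] -> uniq l ->
  near0 (fun t => exists2 G, inverses G (1 - (subordination (size l).-1 t)%:C *: circX l)
    & E G = (e t)^-1%:C).
Proof.
elim: l => [//|i l IH] _ /= /andP[il ul].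
have [->|l0] := eqVneq l [::].
  apply: near0_imp (near0_X_resolvent i) => t [G [GI EG _ _]].
  by exists G; rewrite // /subordination expr0 divr1.
rewrite circX_cons //; set Z := circX l; set s := csqrt (X i).
have ss : s * s = X i by rewrite -expr2; exact: (csqrt_sqr HE).
have [m sm] : exists m, size l = m.+1 by case: (l) l0 => // j l' _; exists (size l').
have {}IH := IH l0 ul; rewrite sm /= -/Z in IH *.
pose F := free_pair_family i (mem l).
have Ffree : freely_alternating E F by apply: (free_pair HE Xfree); rewrite inE.
have Fs c : unital_subspace (F c) by exact: free_pair_subspace.
(* t Ca and t Cb will bound al and be: the 2 comes from |1 - e| <= 2 t, the 2^m from
   [subordination m t <= 2 ^+ m * t]. The threshold in [c0] ensures 2 t Cb Ca < 1. *)
pose Ca := 2 + 4 * cnorm (X i); pose Cb := 2 + 4 * (2 ^+ m * cnorm Z).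
have Ca0 : 0 < Ca by rewrite /Ca; have := cnorm_ge0 (X i); lra.
have Cb0 : 0 < Cb.
  by rewrite /Cb ltr_wpDr // !mulr_ge0 ?cnorm_ge0 ?exprn_ge0.
have c0 : 0 < (2 * (Cb * Ca))^-1 by rewrite invr_gt0 !mulr_gt0.
apply: near0_imp (near0I (near0I (near0_lt c0) near0_reduced_trace_eta)
  (near0I (near0I (near0_X_resolvent i) IH)
    (near0I (near0_subordination m) (near0_subordination_small m Z)))) => t.
case=> [[/andP[t0 tc] [_ e02 et etabd]] [[[Ax [AI EA A2 AF]] [Bz BI EB']] [[w0 w2] wZ]]].
set w := subordination m t in BI w0 w2 wZ.
have h0 : 0 < eta t by case/andP: etabd; lra.
have th0 : 0 < t * eta t by rewrite mulr_gt0.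
have [e0 e2] := andP e02.
have en0 : (e t)%:C != 0 :> R[i] by rewrite (fmorph_eq0 (real_complex R)) lt0r_neq0.
have en1 : (e t)%:C != 1 :> R[i].
  rewrite -(rmorph1 (real_complex R)) (inj_eq (fmorph_inj (real_complex R))).
  by apply/eqP => e1; move: th0; rewrite -et e1 subrr ltxx.
have B2 : cnorm Bz <= 2 by exact: resolvent_cnorm BI wZ.
have fin : forall r : R, (r%:C)^-1 = r^-1%:C :> R[i] by move=> r; rewrite fmorphV.
have FA : F true (1 - (e t)%:C *: Ax).
  have [F1 Fl] := Fs true; rewrite addrC -scaleNr; apply: Fl => //.
have FB : F false (1 - (e t)%:C *: Bz).
  have [F1 Fl] := Fs false; rewrite addrC -scaleNr; apply: Fl => //.
  apply: (resolvent_mem (Fs false) _ _ wZ BI) => [u a|k]; first exact: climit_closure.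
  exact: (@circX_pow_mem (mem l) l k).
have absE : `|1 - e t| <= 2 * t.
  rewrite et gtr0_norm // mulrC ler_pM2r //; by case/andP: etabd.
have nA := cnorm_one_sub_resolvent t0 e02 AI A2.
have nB := cnorm_one_sub_resolvent w0 e02 BI B2.
have {}nA : cnorm (1 - (e t)%:C *: Ax) <= t * Ca by rewrite /Ca; lra.
have {}nB : cnorm (1 - (e t)%:C *: Bz) <= t * Cb.
  apply: le_trans nB _; have := ler_wpM2r (cnorm_ge0 Z) w2.
  by rewrite /Cb -mulrA; lra.
have small : cnorm ((1 - (e t)%:C)^-1 *: ((1 - (e t)%:C *: Bz) * (1 - (e t)%:C *: Ax))) < 1.
  rewrite -{1}(rmorph1 (real_complex R)) -rmorphB -fmorphV et cnormZr.
  rewrite gtr0_norm ?invr_gt0 //.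
  apply: (@le_lt_trans _ _ ((t * 2^-1)^-1 * ((t * Cb) * (t * Ca)))).
    rewrite ler_pM ?invr_ge0 ?cnorm_ge0 ?(ltW th0) //.
      have t2 : 0 < t * 2^-1 by lra.
      by rewrite lef_pV2 ?posrE // ler_pM2l //; case/andP: etabd.
    by rewrite (le_trans (cnormM _ _)) // ler_pM ?cnorm_ge0.
  rewrite [ltLHS](_ : _ = t * (2 * (Cb * Ca))); last by field; exact: lt0r_neq0.
  by rewrite -ltr_pdivlMr ?mulr_gt0 // mul1r.
have [||G GI EG] := free_product_resolvent HE Ffree en0 en1 AI BI _ _ FA FB small.
- by rewrite EA fin.
- by rewrite EB' fin.
(* By 1 - e = t h the argument w becomes t w / (t h) = w / h, one more power of h for each
   factor. *)
have wE : t%:C * w%:C / (1 - (e t)%:C) = (subordination m.+1 t)%:C :> R[i].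
  rewrite -(rmorph1 (real_complex R)) -rmorphB et -fmorphV -!rmorphM; congr _%:C.
  rewrite /w /subordination exprS; field.
  by rewrite expf_neq0 ?lt0r_neq0.
rewrite wE -ss in GI.
have [H HI EH] := conj_resolvent HE GI.
by exists H; rewrite // EH EG fin.
Qed.

Lemma circX_moments_bound l N : l != [::] -> uniq l ->
  tau (circX l ^+ N) <= 2 * (4 * (size l)%:R * cnorm (X i0)) ^+ N.
Proof.
move=> l0 ul; have [m sm] : exists m, size l = m.+1.
  by case: (l) l0 => // j l' _; exists (size l').
rewrite sm.
apply: (@moment_bound _ _ m (boolean_cumulant E (X i0)) (fun k => tau (X i0 ^+ k))
  (fun k => tau (circX l ^+ k)) eta).
- exact: (cnorm_ge1 HE (tauX i0)).
- exact: (boolean_cumulant0 (tauX i0)).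
- exact: (boolean_cumulant_le HE (Xpos i0) (tauX i0)).
- exact: (moment_le HE (Xpos i0)).
- exact: (eta_factor_poly HE (Xpos i0) (tauX i0)).
move=> K; have res := circX_resolvent l0 ul; rewrite sm /= in res.
(* The two resolvents have equal traces, so the truncated moment series differ by the remainders,
   which [D] and [D'] bound using the norm bound 2 on resolvents. *)
pose D := (2 ^+ m) ^+ K * (cnorm (circX l ^+ K) * 2); pose D' := cnorm (X i0 ^+ K) * 2.
exists (D + D').
apply: near0_imp (near0I (near0I (near0_lt ltr01) (near0I res (near0_X_resolvent i0)))
  (near0I (near0_subordination m) (near0_subordination_small m (circX l)))) => t.
case=> [[/andP[t0 _] [[G GI EG] [G0 [G0I EG0 G02 _]]]] [[w0 w2] wZ]].
have G2 := resolvent_cnorm GI wZ.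
have tG : tau G = tau G0 by rewrite /real_trace EG EG0.
have := resolvent_moments E K GI; have := resolvent_moments E K G0I.
rewrite tG !horner_poly -/(subordination m t) => ->.
set S := \sum_(_ < K) _; set S' := \sum_(_ < K) _ => eq.
have -> : S' - S = t ^+ K * tau (X i0 ^+ K * G0)
    - subordination m t ^+ K * tau (circX l ^+ K * G).
  by move: eq; set a := _ * tau (_ * G0); set b := _ * tau _; lra.
rewrite (le_trans (ler_normB _ _)) // [leRHS]mulrDl [leRHS]addrC lerD //.
  rewrite normrM ger0_norm ?exprn_ge0 ?(ltW t0) // mulrC ler_wpM2r ?exprn_ge0 ?(ltW t0) //.
  rewrite (le_trans (normtau_le HE _)) // (le_trans (cnormM _ _)) //.
  by rewrite ler_wpM2l ?cnorm_ge0.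
rewrite normrM ger0_norm ?exprn_ge0 ?(ltW w0) // /D mulrAC -exprMn.
rewrite ler_pM ?exprn_ge0 ?(ltW w0) //.
  by rewrite lerXn2r ?nnegrE ?(ltW w0) // (le_trans (ltW w0)).
rewrite (le_trans (normtau_le HE _)) // (le_trans (cnormM _ _)) //.
by rewrite ler_wpM2l ?cnorm_ge0.
Qed.

End ProductOfFree.

Theorem theorem1 (R : realType) :
  exists c : R, 0 < c /\
    forall (A : cstarAlgType R) (E : {scalar A}), prob_space E ->
    forall (n : nat) (X : 'I_n -> A), (0 < n)%N ->
      (forall i, cpositive (X i)) ->
      free_variables E X ->
      identically_distributed E X ->
      (forall i, E (X i) = 1) ->
      let Y := circ_prod [seq X i | i <- enum 'I_n] in
      forall i : 'I_n,
        cnorm Y <= c * cnorm (X i) * n%:R /\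
        stddev E (X i) * Num.sqrt n%:R <= cnorm Y.
Proof.
(* The 4 of [circX_moments_bound]; the prefactor 2 there disappears when the norm is read off from
   moment growth. *)
exists 4; split=> // A E HE n X n0 Xpos Xfree Xid EX Y i.
have Xid' j k m : E (X j ^+ m) = E (X k ^+ m).
  by case: m => [|m]; [rewrite !expr0|exact: Xid].
have sz : size (enum 'I_n) = n by rewrite size_enum_ord.
have ne : enum 'I_n != [::] by rewrite -size_eq0 sz -lt0n.
have Ypos : cpositive Y by exact: (circX_positive HE Xpos ne).
have L1 := cnorm_ge1 HE (tauX EX i).
have n1 : 0 < n%:R :> R by rewrite ltr0n.
split.
  have -> : 4 * cnorm (X i) * n%:R = 4 * n%:R * cnorm (X i) by rewrite mulrAC.
  apply: (cnorm_le_moments HE (C := 2) Ypos) => [|k]; first by rewrite !mulr_gt0 //; lra.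
  by have := circX_moments_bound HE i Xfree Xpos EX Xid' k ne (enum_uniq _); rewrite sz.
have [_ EY2] := circX_moments2 HE i Xfree Xpos EX Xid' ne (enum_uniq _).
rewrite -/Y in EY2.
have sX := cpositive_self_adjoint (Xpos i); have sY := cpositive_self_adjoint Ypos.
have tX2 := E_self_adjoint HE (csaX 2 sX); have tY2 := E_self_adjoint HE (csaX 2 sY).
rewrite tX2 tY2 sz in EY2.
have {}EY2 : real_trace E (Y ^+ 2) = 1 + n%:R * (real_trace E (X i ^+ 2) - 1).
  apply: real_complexI; rewrite EY2 rmorphD rmorphM rmorphB !rmorph1.
  by rewrite (rmorph_nat (real_complex R)).
have -> : stddev E (X i) = Num.sqrt (real_trace E (X i ^+ 2) - 1).
  rewrite /stddev /variance sX -expr2 EX normr1 expr1n /real_trace.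
  by case: (E _) => u v /=.
(* [sqrtrM] asks for a nonnegative first factor, here the trace of (X i - 1)^2. *)
rewrite -sqrtrM; last first.
  have := tau_sq_ge0 HE (csaB sX csa1).
  rewrite expr2 mulrBr mulrBl !mulr1 mul1r !tauB tau1 // (tauX EX) -expr2; lra.
rewrite -[leRHS]ger0_norm ?cnorm_ge0 // -sqrtr_sqr ler_sqrt ?sqr_ge0 //.
have := tau_square_le HE Y; rewrite sY -expr2 EY2 mulrC; lra.
Qed.
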